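(* For every integer $n \ge 1$, the $n$-ladder graph $P_n \times P_2$ (the Cartesian product of the path on $n$ vertices with the path on $2$ vertices, a graph with $2n$ vertices) has a prime labeling; that is, there is a bijection $f$ from the vertex set of $P_n \times P_2$ onto $\{1, 2, \ldots, 2n\}$ such that $\gcd(f(u), f(v)) = 1$ for every pair of adjacent vertices $u, v$.
   Context: $P_n$ denotes the path graph on $n$ vertices. The $n$-ladder graph is the Cartesian product $P_n \times P_2$: its vertices are the pairs $(i,j)$ with $1 \le i \le n$ and $j \in \{1,2\}$, and $(i,j)$ and $(i',j')$ are adjacent if and only if either $i = i'$ and $j \ne j'$, or $j = j'$ and $|i - i'| = 1$. A prime labeling of a simple graph $G$ with $N$ vertices is a labeling of its vertices with distinct integers from $\{1, 2, \ldots, N\}$ such that the labels of any two adjacent vertices are relatively prime. *)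

(* Defs.v *)
From mathcomp Require Import all_boot.

Set Implicit Arguments.
Unset Strict Implicit.
Unset Printing Implicit Defensive.

(* A finite simple graph is a symmetric irreflexive adjacency
   relation on a finType of vertices. *)

(* The path P_n has vertex set {0, ..., n - 1}. *)
Definition path_graph (n : nat) : rel 'I_n :=
  fun i j => (i.+1 == j :> nat) || (j.+1 == i :> nat).

Definition cartesian_product (T1 T2 : finType) (e1 : rel T1) (e2 : rel T2) :
    rel (T1 * T2) :=
  fun u v => (u.1 == v.1) && e2 u.2 v.2 || (u.2 == v.2) && e1 u.1 v.1.

Definition ladder (n : nat) : rel ('I_n * 'I_2) :=
  cartesian_product (@path_graph n) (@path_graph 2).

Definition prime_labeling (T : finType) (e : rel T) (f : T -> nat) : Prop :=
  [/\ injective f,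
      forall v, 1 <= f v <= #|T|
    & forall u v, e u v -> coprime (f u) (f v)].

Lemma path_graph_sym (n : nat) : symmetric (@path_graph n).
Proof. by move=> i j; rewrite /path_graph orbC. Qed.

Lemma path_graph_irrefl (n : nat) : irreflexive (@path_graph n).
Proof. by move=> i; rewrite /path_graph orbb gtn_eqF. Qed.

Lemma ladder_sym (n : nat) : symmetric (@ladder n).
Proof.
move=> u v; rewrite /ladder /cartesian_product eq_sym path_graph_sym.
by rewrite [v.2 == _]eq_sym [path_graph v.1 _]path_graph_sym.
Qed.

Lemma ladder_irrefl (n : nat) : irreflexive (@ladder n).
Proof.
by move=> u; rewrite /ladder /cartesian_product !path_graph_irrefl !andbF.
Qed.

Lemma ladderE (n : nat) (u v : 'I_n * 'I_2) :
  ladder u v = (u.1 == v.1) && (u.2 != v.2)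
            || (u.2 == v.2) && ((u.1.+1 == v.1 :> nat) || (v.1.+1 == u.1 :> nat)).
Proof.
case: u v => [i [[|[|a]] Ha]] [j [[|[|b]] Hb]] //.
Qed.

Lemma card_ladder (n : nat) : #|{: 'I_n * 'I_2}| = 2 * n.
Proof. by rewrite card_prod !card_ord mulnC. Qed.

(* Main.v *)
From Stdlib Require Import NArith.
Require Import Defs.
From mathcomp Require Import all_boot all_order all_algebra cyclic.
From mathcomp Require Import zify lra.

Set Implicit Arguments.
Unset Strict Implicit.
Unset Printing Implicit Defensive.

(** A ladder labeling is written as the sequence of its columns, each column a
    pair (odd label, even label).  Consecutive columns are turned over, so that
    every rail alternates between odd and even labels; two neighbouring columns
    x and y then meet in x.1, y.2 and in x.2, y.1 ([compatible]).  As 1 and 2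
    are coprime to every label they meet, the column (1, 2) can be put in front
    of any ladder with labels 3, ..., 2n.  Such a ladder exists for every n > 3
    ([fillable_gt3]); the lengths 1, 2 and 3 are labeled by hand.

    The main device is folding.  If p = 2n + 2m + 1 is prime, pair every label
    y of 2m+1, ..., 2n with p - y.  The two labels of a column are coprime
    because their sum is prime, and consecutive columns meet in consecutive
    integers.  The labels 3, ..., 2m are left; by induction they fill a ladder,
    and this ladder is inserted whole between two adjacent columns of the fold
    ([covers_insert]).  Only the two joints can fail, and only four labels, all
    at most 2m, take part in them from the side of the inserted ladder.  An odd
    prime r dividing one of these labels excludes at most one residue class mod
    r of the place of insertion for each of the two joints.

    So a place must be found that avoids, for every prime r dividing the
    product of these four labels, at most two classes mod r.  An elementary
    sieve ([sieve]) with error at most the product of the 1 + c_r, where c_r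
    counts the excluded classes, provides it as soon as
    C m^4 <= ((n - m) / 6)^5 for a constant C <= 2^25 ([fillable_insert]).

    It remains to find a prime 2n + 2m + 1 with 3 < m and m not too close to n
    ([reducible]).
    - For n >= 2^69, the proof by Erdos of Bertrand's postulate gives more: it
      bounds the number of primes in (N, 2N] from below by a constant multiple
      of N / log N, and so the least of them leaves a gap of that order below
      2N ([prime_below_double]).
    - For 2000 <= n < 2^69, an explicit chain of primes does it, each serving
      an interval of lengths n that starts where the previous interval ends
      ([reducible_mid]).
    - For n < 2000, the place of insertion is found by direct search
      ([fillable_small]). *)

(** * Ladders as sequences of columns *)

(** In the ladder, consecutive columns are turned over, so the odd label of
    each stands on the same rail as the even label of the other. *)
Definition compatible (x y : nat * nat) :=
  coprime x.1 y.2 && coprime x.2 y.1.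

Definition rung (x : nat * nat) := odd x.1 && ~~ odd x.2 && coprime x.1 x.2.

Definition labels (s : seq (nat * nat)) :=
  flatten [seq [:: x.1; x.2] | x <- s].

Definition ladder_seq (s : seq (nat * nat)) := all rung s && sorted compatible s.

(** The bounds are those of the half-open interval of labels [a, b). *)
Definition covers (a b : nat) (s : seq (nat * nat)) :=
  ladder_seq s && perm_eq (labels s) (iota a (b - a)).

Lemma labels_cat s t : labels (s ++ t) = labels s ++ labels t.
Proof. by rewrite /labels map_cat flatten_cat. Qed.

Lemma size_labels s : size (labels s) = 2 * size s.
Proof. by elim: s => //= x s; rewrite -/(labels s) => ->; lia. Qed.

Lemma mem_labels s k :
  reflect (exists2 x, x \in s & (k == x.1) || (k == x.2)) (k \in labels s).
Proof.
apply: (iffP flattenP) => [[_ /mapP[x xs ->]] | [x xs kx]].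
  by rewrite !inE => kx; exists x.
by exists [:: x.1; x.2]; [apply: map_f | rewrite !inE].
Qed.

Lemma sorted_cat (T : Type) (e : rel T) x0 (s t : seq T) :
  sorted e s -> sorted e t ->
  (0 < size s -> 0 < size t -> e (last x0 s) (head x0 t)) ->
  sorted e (s ++ t).
Proof.
case: s => [|x s] //=; case: t => [|y t] /=; first by rewrite cats0.
by rewrite cat_path /= => -> -> ->.
Qed.

Lemma ladder_seq_cat x0 s t :
  ladder_seq s -> ladder_seq t ->
  (0 < size s -> 0 < size t -> compatible (last x0 s) (head x0 t)) ->
  ladder_seq (s ++ t).
Proof.
move=> /andP[rs ss] /andP[rt st] st_comp.
by rewrite /ladder_seq all_cat rs rt (sorted_cat ss st st_comp).
Qed.

(** The column at i puts its odd label on rail 0 when i is even and on rail 1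
    when i is odd.  Onto {1, ..., 2n} from a set of 2n vertices, the labeling
    is injective. *)
Lemma covers_prime_labeling n s :
  covers 1 (2 * n).+1 s ->
  exists f : 'I_n * 'I_2 -> nat,
    prime_labeling (@ladder n) f /\
    (forall k : nat, 1 <= k <= 2 * n -> exists v : 'I_n * 'I_2, f v = k).
Proof.
rewrite /covers subSS subn0 => /andP[/andP[/allP rs ss] perm_s].
have size_s : size s = n.
  by have := perm_size perm_s; rewrite size_labels size_iota; lia.
pose f (v : 'I_n * 'I_2) :=
  let c := nth (0, 0) s v.1 in if odd (v.1 + v.2) then c.2 else c.1.
have mem_s k : (k \in labels s) = (1 <= k <= 2 * n).
  by rewrite (perm_mem perm_s) mem_iota; lia.
have f_onto k : 1 <= k <= 2 * n -> exists v, f v = k.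
  rewrite -mem_s => /mem_labels[x /(nthP (0, 0))[i]]; rewrite size_s => lt_in <-.
  move=> kE.
  have lt_b (b : bool) : b < 2 by case: b.
  pose b := odd i (+) (k != (nth (0, 0) s i).1).
  exists (Ordinal lt_in, Ordinal (lt_b b)).
  rewrite /f /= oddD oddb /b addbA addbb addFb.
  by case: eqP kE => [->|_ /eqP].
have f_bound v : 1 <= f v <= #|{: 'I_n * 'I_2}|.
  rewrite card_ladder -mem_s; apply/mem_labels.
  exists (nth (0, 0) s v.1); first by rewrite mem_nth ?size_s.
  by rewrite /f /=; case: ifP; rewrite eqxx ?orbT.
exists f; split=> //; split=> // [|u v].
- have uniq_f : uniq (codom f).
    apply: (@leq_size_uniq _ (iota 1 (2 * n))); first exact: iota_uniq.
    + by move=> k; rewrite mem_iota add1n ltnS => /f_onto[v <-]; apply: codom_f.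
    + by rewrite size_codom card_ladder size_iota.
  by apply/injectiveP.
have rungP i : i < n -> coprime (nth (0, 0) s i).1 (nth (0, 0) s i).2.
  by move=> lt_in; have /rs/andP[] : nth (0, 0) s i \in s by rewrite mem_nth ?size_s.
have stepP i : i.+1 < n -> compatible (nth (0, 0) s i) (nth (0, 0) s i.+1).
  by move=> lt_in; apply/(sortedP (0, 0)) => //; rewrite size_s.
(* By symmetry the edge is a rung or goes to the next column. *)
wlog le_uv : u v / u.1 <= v.1.
  move=> wlog_le e_uv; case: (leqP u.1 v.1) => [|/ltnW] le_uv.
    exact: wlog_le.
  by rewrite coprime_sym; apply: wlog_le; rewrite // ladder_sym.
rewrite ladderE => /orP[/andP[/eqP eq1 neq2] | /andP[/eqP eq2]].
  have := rungP u.1 (ltn_ord _); rewrite /f -eq1 !oddD.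
  case: u v neq2 {eq1 le_uv} => [i [[|[|?]] //= ?]] [j [[|[|?]] //= ?]] _;
    by case: (odd i) => //=; rewrite 1?coprime_sym.
case/orP=> /eqP eq1; last by move: le_uv; rewrite -eq1 ltnn.
have /andP[] : compatible (nth (0, 0) s u.1) (nth (0, 0) s u.1.+1).
  by apply: stepP; rewrite eq1.
rewrite /f -eq1 eq2 !oddD /=.
by case: (odd u.1); case: (odd v.2) => //=; rewrite 1?coprime_sym.
Qed.

(** * Folding an interval around a prime *)

(** For odd i the smaller label 2m + i + 1 is the even one. *)
Definition fold_column m n i :=
  if odd i then (2 * n - i, 2 * m + i.+1) else (2 * m + i.+1, 2 * n - i).

Definition fold_segment m n i l := [seq fold_column m n j | j <- iota i l].

Lemma fold_segment_cat m n i k l :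
  fold_segment m n i k ++ fold_segment m n (i + k) l
  = fold_segment m n i (k + l).
Proof. by rewrite /fold_segment -map_cat -iotaD. Qed.

Lemma coprime_sum_prime p a b :
  prime p -> a + b = p -> 0 < a < p -> coprime a b.
Proof.
move=> p_pr ab a_bd; rewrite /coprime -gcdnDl ab gcdnC.
rewrite -/(coprime p a) prime_coprime //.
by apply: contraTN a_bd => /dvdn_leq; lia.
Qed.

(** From one folded column to the next, lower and upper label exchange their
    parities.  Hence a rail carries either the lower labels or the upper labels
    of both columns, and these are consecutive integers. *)
Lemma fold_column_compatible m n i :
  i < 2 * n -> compatible (fold_column m n i) (fold_column m n i.+1).
Proof.
move=> lt_i; rewrite /compatible /fold_column /=.
have -> : 2 * n - i = (2 * n - i.+1).+1 by lia.
by case: odd; rewrite /= !addnS coprimenS coprimeSn.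
Qed.

Lemma fold_segment_ladder m n i l :
  prime (2 * n + (2 * m).+1) -> i + l <= n - m ->
  ladder_seq (fold_segment m n i l).
Proof.
move=> p_pr le_il; apply/andP; split.
  apply/allP=> x /mapP[j]; rewrite mem_iota => j_bd ->.
  have cop_j : coprime (2 * m + j.+1) (2 * n - j).
    by apply: (coprime_sum_prime p_pr); lia.
  by rewrite /rung /fold_column; case: ifP => oj /=;
    rewrite ?[coprime (2 * n - _) _]coprime_sym cop_j; lia.
apply/(sortedP (0, 0)) => j; rewrite size_map size_iota => lt_j.
rewrite !(nth_map 0) ?size_iota ?(ltnW lt_j) // !nth_iota ?(ltnW lt_j) //.
by rewrite addnS fold_column_compatible //; lia.
Qed.

Lemma labels_fold m n l :
  m + l <= n ->
  perm_eq (labels (fold_segment m n 0 l)) 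
   (iota (2 * m).+1 l ++ iota (2 * n - l).+1 l).
Proof.
elim: l => // l IHl le_l.
rewrite -[X in labels (fold_segment _ _ _ X)]addn1 -fold_segment_cat labels_cat.
have -> : iota (2 * m).+1 l.+1 = iota (2 * m).+1 l ++ [:: 2 * m + l.+1].
  by rewrite -[X in iota _ X = _]addn1 iotaD addSnnS.
have -> : iota (2 * n - l.+1).+1 l.+1 = [:: 2 * n - l] ++ iota (2 * n - l).+1 l.
  by have -> : 2 * n - l = (2 * n - l.+1).+1 by lia.
rewrite catA.
have /IHl : m + l <= n by lia.
move: (labels (fold_segment m n 0 l)) => s.
rewrite add0n => /permP perm_s; apply/permP => a.
rewrite !count_cat perm_s count_cat /labels /fold_segment /= /fold_column.
by case: odd => /=; lia.
Qed.

Lemma labels_foldT m n :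
  m <= n ->
  perm_eq (labels (fold_segment m n 0 (n - m)))
          (iota (2 * m).+1 (2 * (n - m))).
Proof.
move=> le_mn; have := @labels_fold m n (n - m).
rewrite subnKC // => /(_ (leqnn n)).
have -> : 2 * (n - m) = (n - m) + (n - m) by lia.
by rewrite iotaD; have -> : (2 * n - (n - m)).+1 = (2 * m).+1 + (n - m) by lia.
Qed.

Lemma covers_nonempty a b s : a < b -> covers a b s -> 0 < size s.
Proof.
move=> lt_ab /andP[_ /perm_size]; rewrite size_labels size_iota.
by case: size => //; lia.
Qed.

Lemma covers_fold n :
  prime (2 * n + 3) -> 0 < n -> covers 3 (2 * n).+1 (fold_segment 1 n 0 (n - 1)).
Proof.
move=> p_pr n_gt0; rewrite /covers fold_segment_ladder ?addn1 //=.
by rewrite (permPl (labels_foldT n_gt0)) subSS mulnBr.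
Qed.

(** The joint of columns i and i + 1 of the fold is opened, and the inserted
    ladder must be compatible with both sides of it. *)
Lemma covers_insert m n i s x0 :
  prime (2 * n + (2 * m).+1) -> 0 < m -> i.+1 < n - m ->
  covers 3 (2 * m).+1 s ->
  compatible (fold_column m n i) (head x0 s) ->
  compatible (last x0 s) (fold_column m n i.+1) ->
  covers 3 (2 * n).+1
    (fold_segment m n 0 i.+1 ++ s ++ fold_segment m n i.+1 (n - m - i.+1)).
Proof.
move=> p_pr m_gt0 lt_i /andP[lad_s perm_s] comp_h comp_l.
have last_fold : last x0 (fold_segment m n 0 i.+1) = fold_column m n i.
  by rewrite -addn1 -fold_segment_cat last_cat.
have head_fold : head x0 (fold_segment m n i.+1 (n - m - i.+1)) = fold_column m n i.+1.
  by case: (n - m - i.+1) (subn_gt0 i.+1 (n - m)) => [|k]; rewrite ?lt_i.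
apply/andP; split.
  apply: (ladder_seq_cat (x0 := x0)); first by apply: fold_segment_ladder; lia.
    apply: (ladder_seq_cat (x0 := x0)); rewrite ?head_fold ?fold_segment_ladder //; lia.
  rewrite last_fold => _ _; case: s {lad_s perm_s comp_l} comp_h => [|x s] //= _.
  by rewrite head_fold fold_column_compatible //; lia.
have := @labels_foldT m n ltac:(lia).
rewrite -{1}(subnKC (ltnW lt_i)) -fold_segment_cat !labels_cat add0n.
move: (labels (fold_segment m n 0 i.+1)) => s0.
move: (labels (fold_segment m n i.+1 (n - m - i.+1))) => s1.
move=> /permP fold_count; apply/permP => a.
have -> : (2 * n).+1 - 3 = ((2 * m).+1 - 3) + 2 * (n - m) by lia.
rewrite iotaD; have -> : 3 + ((2 * m).+1 - 3) = (2 * m).+1 by lia.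
by rewrite !count_cat (permP perm_s) -fold_count count_cat addnCA.
Qed.

(** * A sieve with a multiplicative error bound *)

(** The class b mod r has L / r members below L, and one more when b is below
    L mod r. *)
Lemma sum_residues r L (F : nat -> nat) :
  0 < r ->
  \sum_(y < L) F y
  = \sum_(b < r) \sum_(t < L %/ r + (b < L %% r)) F (b + r * t).
Proof.
move=> r_gt0.
have blocks q : \sum_(y < q * r) F y = \sum_(b < r) \sum_(t < q) F (b + r * t).
  elim: q => [|q IHq].
    by rewrite mul0n big_ord0 big1 // => b _; rewrite big_ord0.
  rewrite mulSnr big_split_ord /= IHq -big_split /=; apply: eq_bigr => b _.
  by rewrite big_ord_recr /= [q * r]mulnC [r * q + b]addnC.
transitivity (\sum_(y < L %/ r * r + L %% r) F y); first by rewrite -divn_eq.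
rewrite big_split_ord /= blocks.
have lt_s := ltn_pmod L r_gt0; set s := L %% r in lt_s *.
rewrite (big_ord_widen r (fun b => F (L %/ r * r + b))) ?(ltnW lt_s) //.
rewrite [X in _ + X]big_mkcond -big_split /=; apply: eq_bigr => b _.
case: (b < s); last by rewrite !addn0.
by rewrite addn1 big_ord_recr /= [r * _]mulnC [b + _ * r]addnC.
Qed.

(** b |-> a + d b permutes the residues mod r. *)
Lemma sum_shift_residues r a d (P : pred nat) :
  0 < r -> coprime d r -> (forall x, P (x %% r) = P x) ->
  \sum_(b < r) P (a + d * b) = \sum_(b < r) P b.
Proof.
move=> r_gt0 cop_d P_mod; case: r r_gt0 cop_d P_mod => // r _ cop_d P_mod.
pose h (b : 'I_r.+1) := Ordinal (ltn_pmod (a + d * b) (ltn0Sn r)).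
have h_inj : injective h.
  move=> b1 b2 /(congr1 val) /= /eqP; rewrite eqn_modDl.
  wlog le_b : b1 b2 / b1 <= b2 => [wl|].
    by case: (leqP b1 b2) => [/wl//|/ltnW/wl H]; rewrite eq_sym => /H.
  rewrite eq_sym eqn_mod_dvd ?leq_mul2l ?le_b ?orbT // -mulnBr.
  rewrite Gauss_dvdr 1?coprime_sym // => /dvdnP[[|k] E]; apply/val_inj => /=.
    by lia.
  by have := ltn_ord b2; lia.
by rewrite [RHS](reindex_inj h_inj); apply: eq_bigr => b _ /=; rewrite P_mod.
Qed.

Section Sieve.

Import Order.TTheory GRing.Theory Num.Theory.

Definition residue_count (bad : nat -> pred nat) r := \sum_(b < r) bad r b.

(** [bad r] is the set of excluded positions at r, in the applications a union
    of residue classes mod r. *)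
Definition unsieved (bad : nat -> pred nat) R x := all (fun r => ~~ bad r x) R.

Definition unsieved_count (bad : nat -> pred nat) R a d L :=
  \sum_(y < L) unsieved bad R (a + d * y).

Local Open Scope ring_scope.

Definition density (bad : nat -> pred nat) R : rat :=
  \prod_(r <- R) (1 - (residue_count bad r)%:R / r%:R).

Definition error_bound (bad : nat -> pred nat) R : rat :=
  \prod_(r <- R) (1 + (residue_count bad r)%:R).

Lemma residue_count_le bad r : (residue_count bad r <= r)%N.
Proof.
rewrite -[leqRHS]card_ord -sum1_card /residue_count; apply: leq_sum => b _.
exact: leq_b1.
Qed.

Lemma density_bounds bad R : all prime R -> 0 <= density bad R <= 1.
Proof.
rewrite /density; elim: R => [|r R IHR] /=; first by rewrite big_nil ler01 lexx.
move=> /andP[/prime_gt0 r_gt0 /IHR/andP[ge0 le1]]; rewrite big_cons.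
have /andP[q0 q1] : is_true (0 <= ((residue_count bad r)%:R / r%:R : rat) <= 1).
  rewrite divr_ge0 ?ler0n //= ler_pdivrMr ?ltr0n // mul1r ler_nat.
  exact: residue_count_le.
by apply/andP; split; nra.
Qed.

(** By inclusion and exclusion over one prime r at a time: the positions lost
    at r form c = [residue_count bad r] subprogressions of step d r and of
    length L / r up to 1, on each of which the remaining primes are sieved with
    error at most [error_bound bad R].  The error therefore grows by a factor
    1 + c.  Arbitrary progressions are needed to carry the induction. *)
Lemma sieve (bad : nat -> pred nat) R :
  (forall r x, bad r (x %% r)%N = bad r x) ->
  uniq R -> all prime R ->
  forall a d L : nat, all (coprime d) R ->
  `|(unsieved_count bad R a d L)%:R - density bad R * L%:R|
    <= error_bound bad R - 1.
Proof.
move=> bad_mod.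
elim: R => [_ _ a d L _|r R IHR /= /andP[rNR uR] /andP[r_pr pR] a d L].
  rewrite /density /error_bound !big_nil mul1r subrr.
  by rewrite /unsieved_count sum1_card card_ord subrr normr0.
move=> /andP[cop_dr cop_dR]; have r_gt0 := prime_gt0 r_pr.
have {}IHR := IHR uR pR; have /andP[dens_ge0 dens_le1] := density_bounds bad pR.
pose len (b : nat) := (L %/ r + (b < L %% r))%N.
pose hits b := unsieved_count bad R (a + d * b) (d * r) (len b).
have cop_drR : all (coprime (d * r)) R.
  apply/allP=> q qR; rewrite coprimeMl (allP cop_dR q qR) /=.
  rewrite prime_coprime // dvdn_prime2 //; last exact: (allP pR).
  by apply: contraNneq rNR => ->.
have split_r : (unsieved_count bad R a d L
    = unsieved_count bad (r :: R) a d L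
      + \sum_(b < r | bad r (a + d * b)%N) hits b)%N.
  rewrite {1}/unsieved_count.
  rewrite (eq_bigr (fun y : 'I_L => unsieved bad (r :: R) (a + d * y)%N
     + (bad r (a + d * y)%N && unsieved bad R (a + d * y)%N))%N); last first.
    by move=> y _; rewrite /unsieved /=; case: (bad r _) => //=; rewrite addn0.
  rewrite big_split /=; congr addn.
  rewrite (@sum_residues r L (fun y =>
    bad r (a + d * y)%N && unsieved bad R (a + d * y)%N) r_gt0).
  rewrite [RHS]big_mkcond; apply: eq_bigr => b _ /=.
  rewrite (eq_bigr (fun t : 'I_(len b) =>
     bad r (a + d * b)%N && unsieved bad R (a + d * b + d * r * t)%N : nat)); last first.
    move=> t _; rewrite mulnDr addnA mulnA; congr (nat_of_bool (_ && _)).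
    by rewrite -[LHS]bad_mod mulnAC addnC modnMDl bad_mod.
  by case: (bad r _) => //; rewrite big1.
(* The error E - 1 of the induction hypothesis and the error, at most 1, of
   replacing the length by L / r add up to E. *)
have hitsP (b : 'I_r) : bad r (a + d * b)%N ->
    `|(hits b)%:R - density bad R * (L%:R / r%:R)| <= error_bound bad R.
  move=> _; have := IHR (a + d * b)%N (d * r)%N (len b) cop_drR.
  rewrite -/(hits b) => IHb.
  have len_err : `|(len b)%:R - L%:R / r%:R| <= 1 :> rat.
    have lt_s := ltn_pmod L r_gt0; rewrite /len.
    have -> : L%:R / r%:R = (L %/ r)%:R + (L %% r)%:R / r%:R :> rat.
      rewrite {1}(divn_eq L r) natrD natrM mulrDl mulfK //.
      by rewrite pnatr_eq0 -lt0n.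
    have /andP[s0 s1] : is_true (0 <= ((L %% r)%:R / r%:R : rat) <= 1).
      by rewrite divr_ge0 ?ler0n //= ler_pdivrMr ?ltr0n // mul1r ler_nat ltnW.
    rewrite natrD ler_norml; case: (b < _)%N; rewrite /=; lra.
  move: IHb len_err; rewrite !ler_norml => /andP[? ?] /andP[? ?].
  by apply/andP; split; nra.
have sum_hits : `|(\sum_(b < r | bad r (a + d * b)) hits b)%N%:R
    - (residue_count bad r)%:R * (density bad R * (L%:R / r%:R))|
    <= (residue_count bad r)%:R * error_bound bad R.
  rewrite /residue_count -(sum_shift_residues a r_gt0 cop_dr (bad_mod r)).
  rewrite -big_mkcond !natr_sum !mulr_suml -sumrB.
  apply: (le_trans (ler_norm_sum _ _ _)); apply: ler_sum => b bad_b.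
  by rewrite !mul1r; apply: hitsP.
have := IHR a d L cop_dR; rewrite split_r natrD.
have -> : density bad (r :: R)
    = (1 - (residue_count bad r)%:R / r%:R) * density bad R by rewrite /density big_cons.
have -> : error_bound bad (r :: R)
    = (1 + (residue_count bad r)%:R) * error_bound bad R by rewrite /error_bound big_cons.
move: sum_hits; rewrite mulrA [_ * (L%:R / _)]mulrCA mulrA.
rewrite !ler_norml => /andP[? ?] /andP[? ?].
apply/andP; split; lra.
Qed.

End Sieve.

(** * Clashes at a joint and their cost in the sieve *)

(** The column (o, e), odd label first, is next to a column of the fold with
    labels y and p - y, such that y meets e and p - y meets o.  The prime r
    divides both labels of one of these pairs. *)
Definition clash p o e r y :=
  (r %| e) && (y == 0 %[mod r]) || (r %| o) && (y == p %[mod r]).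

Lemma clash_mod p o e r y : clash p o e r (y %% r) = clash p o e r y.
Proof. by rewrite /clash !modn_mod. Qed.

Lemma eq_of_double_mod r k a b :
  odd r -> a < r -> b < r -> k + 2 * a = k + 2 * b %[mod r] -> a = b.
Proof.
move=> r_odd; wlog le_ab : a b / a <= b => [wl|] lt_a lt_b.
  by case: (leqP a b) => [/wl|/ltnW/wl H /esym/H]; [apply|move->].
move/eqP; rewrite eqn_modDl eq_sym eqn_mod_dvd ?leq_mul2l // -mulnBr.
rewrite Gauss_dvdr ?coprimen2 // => /dvdnP[[|c] E]; lia.
Qed.

Lemma sum_bool_le1 r (P : pred nat) :
  (forall a b, a < r -> b < r -> P a -> P b -> a = b) -> \sum_(b < r) P b <= 1.
Proof.
move=> P_inj; rewrite -big_mkcond sum1_card.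
by apply/card_le1_eqP => a b Pa Pb; apply/val_inj/P_inj => /=; rewrite ?ltn_ord.
Qed.

(** As o and e are coprime, r divides only one of them and only one of the two
    congruences defining [clash] is active. *)
Lemma clash_residues p o e r k :
  prime r -> odd r -> coprime o e ->
  \sum_(b < r) clash p o e r (k + 2 * b) <= (r %| o * e).
Proof.
move=> r_pr r_odd cop_oe; rewrite Euclid_dvdM //.
have := @sum_bool_le1 r (fun b => clash p o e r (k + 2 * b)).
rewrite /clash; case r_o: (r %| o); case r_e: (r %| e) => /= le1.
- have : r %| gcdn o e by rewrite dvdn_gcd r_o r_e.
  by rewrite (eqP cop_oe) dvdn1 => /eqP r1; rewrite r1 in r_pr.
- by apply: le1 => a b lt_a lt_b /eqP <- /eqP/esym; apply: eq_of_double_mod.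
- apply: le1 => a b lt_a lt_b; rewrite !orbF => /eqP <- /eqP/esym.
  exact: eq_of_double_mod.
- by rewrite big1.
Qed.

Lemma clash_free_coprime p o e y z :
  0 < o -> 0 < e -> odd z || odd o -> odd y || odd e -> y + z = p ->
  (forall r, prime r -> odd r -> r %| o * e -> ~~ clash p o e r y) ->
  coprime z o && coprime y e.
Proof.
move=> o_gt0 e_gt0 zo_odd ye_odd yz_p free.
have coprimeP a b : 0 < b -> (forall r, prime r -> r %| a -> r %| b -> False) -> coprime a b.
  move=> b_gt0 H; apply: contraT; rewrite /coprime => /eqP/eqP ncop.
  have g_gt1 : 1 < gcdn a b by have := gcdn_gt0 a b; rewrite b_gt0 orbT; lia.
  case: (H _ (pdiv_prime g_gt1)); apply: dvdn_trans (pdiv_dvd _) _.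
    exact: dvdn_gcdl.
  exact: dvdn_gcdr.
apply/andP; split; apply: coprimeP => //.
  move=> r r_pr r_z r_o; have r_odd : odd r.
    by case/orP: zo_odd => [/(dvdn_odd r_z)|/(dvdn_odd r_o)].
  have := free r r_pr r_odd (dvdn_mulr _ r_o).
  by rewrite /clash r_o -yz_p -modnDmr (eqP r_z) addn0 eqxx orbT.
move=> r r_pr r_y r_e; have r_odd : odd r.
  by case/orP: ye_odd => [/(dvdn_odd r_y)|/(dvdn_odd r_e)].
have := free r r_pr r_odd (dvdn_mull _ r_e).
by rewrite /clash r_e mod0n [_ == 0]r_y.
Qed.

(** For these primes, and only for these among the primes r > 3, a factor
    besides r^c is needed in [sieve_cost]. *)
Definition small_sieve_primes := [:: 5; 7; 11; 13; 17; 19; 23; 29; 31].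

(** The least integers w for which ((c + 1) r / (r - c))^5 <= w r^c holds for
    c = 1 and c = 2. *)
Definition small_sieve_weights := [:: 125; 27; 6; 4; 3; 3; 2; 2; 2].

Definition sieve_weight r :=
  nth 1 small_sieve_weights (index r small_sieve_primes).

Lemma sieve_weight_gt0 r : 0 < sieve_weight r.
Proof.
rewrite /sieve_weight; set i := index _ _.
have [lt_i|ge_i] := ltnP i (size small_sieve_weights); last by rewrite nth_default.
exact: (elimT (@all_nthP _ (leq 1) small_sieve_weights 1) isT i lt_i).
Qed.

(** Excluding c classes at r multiplies the length needed in the sieve by
    (1 + c) / (1 - c / r).  The fifth power of this is at most r^c up to a
    constant, and a constant other than 1 is needed only below 37.  As the
    primes in question divide four labels of size at most 2m, the product of
    the r^c is O(m^4), and a length of order m^(4/5) suffices. *)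
Lemma sieve_cost r c k :
  prime r -> 3 < r -> c <= k <= 2 ->
  (c.+1 * r) ^ 5 <= sieve_weight r * r ^ k * (r - c) ^ 5.
Proof.
move=> r_pr r_gt3 /andP[le_ck le_k2].
have r_gt0 := prime_gt0 r_pr.
apply: (@leq_trans (sieve_weight r * r ^ c * (r - c) ^ 5)); last first.
  by rewrite leq_mul2r leq_mul2l leq_pexp2l ?orbT.
have {k le_ck le_k2} : c <= 2 by lia.
case: (leqP 37 r) => [le37 le_c2|].
  apply: (@leq_trans (1 * r ^ c * (r - c) ^ 5)); last first.
    by rewrite leq_mul2r leq_mul2r sieve_weight_gt0 !orbT.
  rewrite -(subnKC le37); set t := r - 37.
  case: c le_c2 => [|[|[|//]]] _.
  - by rewrite !mul1n subn0.
  - have -> : 37 + t - 1 = 36 + t by lia.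
    nia.
  - have -> : 37 + t - 2 = 35 + t by lia.
    nia.
move=> lt37 le_c2.
have : r \in [seq q <- iota 4 33 | prime q].
  by rewrite mem_filter r_pr mem_iota r_gt3 lt37.
have -> : [seq q <- iota 4 33 | prime q] = small_sieve_primes by [].
rewrite !inE => r_in.
do 8!(case/orP: r_in => [/eqP->|r_in];
  first by rewrite /sieve_weight /small_sieve_weights /=;
        case: c le_c2 => [|[|[|//]]] _; lia).
by move/eqP: r_in => ->; rewrite /sieve_weight /small_sieve_weights /=;
   case: c le_c2 => [|[|[|//]]] _; lia.
Qed.

(** * Existence of a survivor *)

Section Survivors.

Import Order.TTheory GRing.Theory Num.Theory.

Lemma error_bound_density (bad : nat -> pred nat) R (k : nat -> nat) :
  all prime R -> all (ltn 3) R ->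
  (forall r, r \in R -> residue_count bad r <= k r <= 2) ->
  (error_bound bad R ^+ 5
   <= (\prod_(r <- R) (sieve_weight r * r ^ k r)%N)%:R * density bad R ^+ 5)%R.
Proof.
move=> pR oR kR; rewrite /error_bound /density -!prodrXl natr_prod -big_split /=.
rewrite big_seq [leRHS]big_seq; apply: ler_prod => r rR.
have r_pr := allP pR r rR; set c := residue_count bad r.
have r_neq0 : (r%:R != 0 :> rat)%R by rewrite pnatr_eq0 -lt0n prime_gt0.
have le_cr : c <= r := residue_count_le bad r.
rewrite exprn_ge0 ?addr_ge0 ?ler0n //=.
have -> : (1 - c%:R / r%:R = (r - c)%:R / r%:R :> rat)%R.
  by rewrite natrB // mulrBl divff.
rewrite expr_div_n mulrA ler_pdivlMr ?exprn_gt0 ?ltr0n ?prime_gt0 //.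
rewrite -exprMn nat1r -natrM -!natrX -natrM ler_nat.
exact: sieve_cost (allP oR r rR) (kR r rR).
Qed.

(** Without survivor, the density times L would be smaller than the error
    bound. *)
Lemma sieve_survivor (bad : nat -> pred nat) R (k : nat -> nat) a d L :
  (forall r x, bad r (x %% r) = bad r x) ->
  uniq R -> all prime R -> all (ltn 3) R ->
  (forall r, r \in R -> residue_count bad r <= k r <= 2) ->
  all (coprime d) R ->
  \prod_(r <- R) (sieve_weight r * r ^ k r) <= L ^ 5 ->
  exists2 x, x < L & unsieved bad R (a + d * x).
Proof.
move=> bad_mod uR pR oR kR cop_d le_L.
have /andP[dens_ge0 _] := density_bounds bad pR.
have err_le : (error_bound bad R <= density bad R * L%:R)%R.
  rewrite -(@ler_pXn2r _ 5) ?nnegrE ?mulr_ge0 ?ler0n //; last first.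
    by apply: prodr_ge0 => r _; rewrite addr_ge0 ?ler0n.
  apply: (le_trans (error_bound_density pR oR kR)).
  by rewrite exprMn mulrC ler_wpM2l ?exprn_ge0 // -natrX ler_nat.
case: (boolP [exists x : 'I_L, unsieved bad R (a + d * x)]) => [/existsP[x] ?|none].
  by exists x.
have := sieve bad_mod uR pR a L cop_d.
rewrite /unsieved_count big1 => [|x _]; last first.
  by apply/eqP; rewrite eqb0; apply: contra none => ?; apply/existsP; exists x.
rewrite ler_norml => /andP[? _]; exfalso; lra.
Qed.

End Survivors.

Lemma prod_le_subset (I : eqType) (w : I -> nat) (R S : seq I) :
  uniq R -> uniq S -> (forall i, i \in S -> 0 < w i) -> {subset R <= S} ->
  \prod_(i <- R) w i <= \prod_(i <- S) w i.
Proof.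
move=> uR uS w_gt0 sRS; rewrite [leqRHS](bigID (mem R)) /= -[X in _ <= X * _]big_filter.
rewrite [X in _ <= X * _](perm_big R) /=; last first.
  apply: uniq_perm; rewrite ?filter_uniq // => i.
  by rewrite mem_filter /=; case iR: (i \in R) => //=; rewrite sRS.
by rewrite leq_pmulr // big_seq_cond prodn_cond_gt0 // => i /andP[/w_gt0].
Qed.

Lemma prod_le_support (I : eqType) (w : I -> nat) (R S : seq I) :
  uniq R -> uniq S -> (forall i, 0 < w i) -> (forall i, i \notin S -> w i = 1) ->
  \prod_(i <- R) w i <= \prod_(i <- S) w i.
Proof.
move=> uR uS w_gt0 w1; rewrite (bigID (mem S)) /=.
rewrite [X in _ * X]big1 // muln1 -big_filter.
apply: prod_le_subset; rewrite ?filter_uniq // => i.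
by rewrite mem_filter => /andP[].
Qed.

Lemma prod_sieve_weight R :
  uniq R ->
  \prod_(r <- R) sieve_weight r <= \prod_(r <- small_sieve_primes) sieve_weight r.
Proof.
move=> uR; apply: prod_le_support => // [r|r rN]; first exact: sieve_weight_gt0.
by rewrite /sieve_weight nth_default // leqNgt index_mem.
Qed.

Lemma prod_primes_dvd R n : 
  uniq R -> all prime R -> all (dvdn^~ n) R -> \prod_(r <- R) r %| n.
Proof.
elim: R => [|r R IHR] /=; first by rewrite big_nil dvd1n.
move=> /andP[rNR uR] /andP[r_pr pR] /andP[r_n nR].
rewrite big_cons Gauss_dvd ?r_n ?IHR //.
elim: R rNR pR {IHR uR nR} => [|q R IHR] /=; first by rewrite big_nil coprimen1.
rewrite inE negb_or big_cons coprimeMr => /andP[neq rNR] /andP[q_pr pR].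
by rewrite IHR // andbT prime_coprime // dvdn_prime2.
Qed.

Lemma prod_dividing_le R n :
  0 < n -> uniq R -> all prime R -> \prod_(r <- R) r ^ (r %| n) <= n.
Proof.
move=> n_gt0 uR pR; apply: dvdn_leq => //.
rewrite (eq_bigr (fun r => if r %| n then r else 1)); last first.
  by move=> r _; case: (r %| n).
rewrite -big_mkcond -big_filter; apply: prod_primes_dvd.
- exact: filter_uniq.
- by apply/allP=> r; rewrite mem_filter => /andP[_ /(allP pR)].
- by apply/allP=> r; rewrite mem_filter => /andP[].
Qed.

(** The factor 2 is the prime 2 of the even number n; it is responsible for
    the 4 in [compatible_cut]. *)
Lemma prod_odd_dividing_le R n :
  0 < n -> ~~ odd n -> uniq R -> all prime R -> all (ltn 3) R ->
  2 * \prod_(r <- R) r ^ (r %| n) <= n.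
Proof.
move=> n_gt0 n_even uR pR R_gt3; have := @prod_dividing_le (2 :: R) n n_gt0.
rewrite big_cons dvdn2 n_even expn1 /= uR pR => -> //.
by rewrite andbT; apply/negP => /(allP R_gt3).
Qed.

(** * Inserting a ladder into a fold *)

Definition fillable n := exists s, covers 3 (2 * n).+1 s.

Definition sieve_constant := 4 * \prod_(r <- small_sieve_primes) sieve_weight r.

Lemma covers_mem a b s x :
  covers a b s -> x \in s -> [/\ rung x, a <= x.1 < b & a <= x.2 < b].
Proof.
move=> /andP[/andP[/allP rs _] perm_s] xs.
have mem_x k : k \in [:: x.1; x.2] -> a <= k < b.
  move=> kx; have : k \in labels s.
    by apply/mem_labels; exists x => //; move: kx; rewrite !inE.
  by rewrite (perm_mem perm_s) mem_iota; lia.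
by split; [exact: rs | apply: mem_x; rewrite !inE eqxx ?orbT..].
Qed.

(** A place for a ladder with end columns u and v.  Only even places i = 2x
    are tried, for which the orientation of the fold is known, and x is first
    fixed modulo 3: sieving by 3, where two of the three classes may be
    excluded, would cost a factor 9 instead of 3.  Hence the 6 in the bound.
    The prime 2 never clashes, since the labels that meet have opposite
    parities. *)
Lemma compatible_cut m n (u v : nat * nat) :
  rung u -> rung v -> 0 < u.2 -> 0 < v.2 ->
  \prod_(r <- small_sieve_primes) sieve_weight r * (u.1 * u.2 * (v.1 * v.2))
    <= 4 * ((n - m) %/ 6) ^ 5 ->
  exists2 i, i.+1 < n - m &
    compatible (fold_column m n i) u && compatible v (fold_column m n i.+1).
Proof.
move=> /andP[/andP[u1_odd u2_even] cop_u] /andP[/andP[v1_odd v2_even] cop_v].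
move=> u2_gt0 v2_gt0 le_L.
set U := u.1 * u.2 in le_L; set V := v.1 * v.2 in le_L.
have U_gt0 : 0 < U by rewrite muln_gt0 odd_gt0.
have V_gt0 : 0 < V by rewrite muln_gt0 odd_gt0.
have U_even : ~~ odd U by rewrite oddM (negPf u2_even) andbF.
have V_even : ~~ odd V by rewrite oddM (negPf v2_even) andbF.
pose p := 2 * n + (2 * m).+1.
pose bad r x := clash p u.1 u.2 r ((2 * m).+1 + 2 * x)
             || clash p v.2 v.1 r ((2 * m).+2 + 2 * x).
pose R := [seq r <- primes (U * V) | 3 < r].
pose k r := (r %| U) + (r %| V).
have uR : uniq R by rewrite filter_uniq ?primes_uniq.
have pR : all prime R.
  by apply/allP=> r; rewrite mem_filter mem_primes => /and3P[].
have R_gt3 : all (ltn 3) R by apply: filter_all.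
have bad_mod r x : bad r (x %% r) = bad r x.
  have dbl c : clash p u.1 u.2 r (c + 2 * (x %% r)) = clash p u.1 u.2 r (c + 2 * x).
    by rewrite -clash_mod -modnDmr modnMmr modnDmr clash_mod.
  have dbl' c : clash p v.2 v.1 r (c + 2 * (x %% r)) = clash p v.2 v.1 r (c + 2 * x).
    by rewrite -clash_mod -modnDmr modnMmr modnDmr clash_mod.
  by rewrite /bad dbl dbl'.
have count_le r : prime r -> odd r -> residue_count bad r <= k r <= 2.
  move=> r_pr r_odd.
  apply/andP; split; last by rewrite /k; case: (r %| U); case: (r %| V).
  apply: (@leq_trans (\sum_(b < r) clash p u.1 u.2 r ((2 * m).+1 + 2 * b)
                    + \sum_(b < r) clash p v.2 v.1 r ((2 * m).+2 + 2 * b))).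
    by rewrite -big_split; apply: leq_sum => b _; rewrite /bad; do 2!case: clash.
  rewrite /k [V]mulnC; apply: leq_add; apply: clash_residues => //.
  by rewrite coprime_sym.
have odd_gt3 r : prime r -> 3 < r -> odd r.
  by move=> /even_prime[->|].
have kR r : r \in R -> residue_count bad r <= k r <= 2.
  move=> rR; have r_pr := allP pR r rR.
  by apply: count_le => //; apply: odd_gt3 => //; apply: (allP R_gt3).
(* At most two of the three classes mod 3 are bad. *)
have [a lt_a3 a_good] : exists2 a, a < 3 & ~~ bad 3 a.
  case: (boolP [exists a : 'I_3, ~~ bad 3 a]) => [/existsP[a]|none]; first by exists a.
  have /andP[] := @count_le 3 isT isT; rewrite /residue_count.
  rewrite (eq_bigr (fun=> 1)) ?sum1_card ?card_ord => [le3 le2|a _].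
    by have := leq_trans le3 le2.
  by move: none; rewrite negb_exists => /forallP/(_ a); rewrite negbK => ->.
have bound : \prod_(r <- R) (sieve_weight r * r ^ k r) <= ((n - m) %/ 6) ^ 5.
  rewrite -(leq_pmul2l (isT : 0 < 4)); apply: leq_trans le_L.
  rewrite big_split /= mulnCA; apply: leq_mul; first exact: prod_sieve_weight.
  rewrite (eq_bigr (fun r => r ^ (r %| U) * r ^ (r %| V))); last first.
    by move=> r _; rewrite -expnD.
  rewrite big_split /= -[4]/(2 * 2) mulnACA.
  by apply: leq_mul; apply: prod_odd_dividing_le.
have cop3 : all (coprime 3) R.
  apply/allP=> r rR; rewrite prime_coprime // dvdn_prime2 //; last exact: (allP pR).
  by apply: contraTneq (allP R_gt3 r rR) => <-.
have [y lt_y /allP y_good] := sieve_survivor a bad_mod uR pR R_gt3 kR cop3 bound.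
set x := a + 3 * y in y_good.
have x_good r : prime r -> odd r -> r %| U * V -> ~~ bad r x.
  move=> r_pr r_odd r_UV; have [r_gt3|r_le3] := ltnP 3 r.
    by apply: y_good; rewrite mem_filter mem_primes r_pr r_gt3 muln_gt0 U_gt0 V_gt0.
  have -> : r = 3 by move: r_odd r_le3 (prime_gt1 r_pr); case: (r) => [|[|[|[|]]]].
  by rewrite -bad_mod /x mulnC addnC modnMDl bad_mod.
exists (2 * x); first by lia.
have cut_u : coprime (2 * n - 2 * x) u.1 && coprime (2 * m + (2 * x).+1) u.2.
  apply: (@clash_free_coprime p) => //; try by rewrite ?u1_odd ?orbT //; lia.
  move=> r r_pr r_odd r_U; have := x_good r r_pr r_odd (dvdn_mulr _ r_U).
  by rewrite /bad negb_or addSnnS => /andP[].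
have cut_v : coprime (2 * n - (2 * x).+1) v.2 && coprime (2 * m + (2 * x).+2) v.1.
  apply: (@clash_free_coprime p) => //; try by rewrite ?v1_odd ?orbT //; lia.
  move=> r r_pr r_odd; rewrite mulnC => r_V.
  have := x_good r r_pr r_odd (dvdn_mull _ r_V).
  by rewrite /bad negb_or !addSnnS => /andP[].
move: cut_u cut_v; rewrite /compatible /fold_column /= oddM /=.
rewrite andbC => -> /andP[cop2 cop1].
by rewrite coprime_sym cop1 coprime_sym cop2.
Qed.

(** The end labels of the inserted ladder are at most 2m, so the product of the
    four in [compatible_cut] is at most 16 m^4. *)
Lemma fillable_insert m n :
  prime (2 * n + (2 * m).+1) -> 1 < m -> fillable m ->
  sieve_constant * m ^ 4 <= ((n - m) %/ 6) ^ 5 -> fillable n.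
Proof.
move=> p_pr m_gt1 [s cov_s] le_L; pose x0 := (0, 0).
have s_gt0 : 0 < size s by apply: covers_nonempty cov_s; lia.
have [] : head x0 s \in s /\ last x0 s \in s.
  by case: s {cov_s} s_gt0 => //= x s _; rewrite mem_head mem_last.
move=> /(covers_mem cov_s)[ru /andP[_ u1_le] /andP[/ltnW/ltnW u2_gt0 u2_le]].
move=> /(covers_mem cov_s)[rv /andP[_ v1_le] /andP[/ltnW/ltnW v2_gt0 v2_le]].
have le_prod : \prod_(r <- small_sieve_primes) sieve_weight r
    * ((head x0 s).1 * (head x0 s).2 * ((last x0 s).1 * (last x0 s).2))
    <= 4 * ((n - m) %/ 6) ^ 5.
  apply: (@leq_trans (4 * (sieve_constant * m ^ 4))); last by rewrite leq_mul2l.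
  rewrite /sieve_constant; set W := \prod_(r <- _) _.
  have -> : 4 * (4 * W * m ^ 4) = W * (2 * m * (2 * m) * (2 * m * (2 * m))).
    by rewrite !expnS; nia.
  by rewrite leq_mul2l; apply/orP; right; apply: leq_mul; apply: leq_mul.
have [i lt_i /andP[cut_u cut_v]] := compatible_cut ru rv u2_gt0 v2_gt0 le_prod.
by exists (fold_segment m n 0 i.+1 ++ s ++ fold_segment m n i.+1 (n - m - i.+1));
   apply: covers_insert cut_u cut_v => //; lia.
Qed.

(** * The central binomial coefficient and the primorial *)

Lemma leq_central_bin N : 0 < N -> 4 ^ N <= 2 * N * 'C(2 * N, N).
Proof.
case: N => // N _; elim: N => // N; set n := N.+1 => IHn.
have := mul_bin_diag (2 * n.+1) n; have := mul_bin_down (2 * n).+1 n.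
have -> : (2 * n.+1).-1 = (2 * n).+1 by lia.
have -> : (2 * n).+1 - n = n.+1 by lia.
move: IHn; rewrite [4 ^ n.+1]expnS /=.
move: 'C(2 * n, n) 'C((2 * n).+1, n) 'C(2 * n.+1, n.+1) (4 ^ n) => d b a x.
nia.
Qed.

Lemma bin_odd_le m : 'C((2 * m).+1, m) <= 4 ^ m.
Proof.
elim: m => // m; rewrite expnS.
have := mul_bin_down (2 * m).+3 m.+1; have := mul_bin_diag (2 * m).+2 m.
have -> : (2 * m).+3 - m.+1 = m.+2 by lia.
have -> : (2 * m.+1).+1 = (2 * m).+3 by lia.
rewrite /=; move: 'C((2 * m).+1, m) 'C((2 * m).+2, m.+1) 'C((2 * m).+3, m.+1) => a b c.
move: (4 ^ m) => x; nia.
Qed.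

Definition primes_between a l := [seq p <- iota a l | prime p].

Lemma primes_betweenP a l : uniq (primes_between a l) /\ all prime (primes_between a l).
Proof.
by rewrite filter_uniq ?iota_uniq //; split=> //; apply: filter_all.
Qed.

Lemma dvdn_fact_prime p n : prime p -> (p %| n`!) = (p <= n).
Proof.
move=> p_pr; apply/idP/idP => [|le_pn]; last by rewrite dvdn_fact // prime_gt0.
elim: n => [|n IHn]; first by rewrite dvdn1 => /eqP p1; rewrite p1 in p_pr.
rewrite factS Euclid_dvdM // => /orP[/dvdn_leq|/IHn /leqW] //; exact.
Qed.

(** The primes in question divide the numerator (2m+1)! and not the
    denominator m! (m+1)!. *)
Lemma prod_primes_between_dvd m :
  \prod_(p <- primes_between m.+2 m) p %| 'C((2 * m).+1, m).
Proof.
have [u_pr all_pr] := primes_betweenP m.+2 m; apply: prod_primes_dvd => //.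
apply/allP=> p; rewrite mem_filter mem_iota => /andP[p_pr p_bd].
have := @bin_fact (2 * m).+1 m ltac:(lia) => bf.
have : p %| ((2 * m).+1)`! by rewrite dvdn_fact_prime //; lia.
by rewrite -bf !Euclid_dvdM // !dvdn_fact_prime //; lia.
Qed.

(** Strong induction: for y = 2m + 1, the primes up to m + 1 are covered by
    induction and those in m + 2, ..., 2m + 1 divide a binomial coefficient
    that is at most 4^m; an even y > 2 is not prime. *)
Lemma primorial_le x : \prod_(p <- primes_between 0 x.+1) p <= 4 ^ x.
Proof.
elim/ltn_ind: x => -[|[|[|x]]] IHx; try by rewrite unlock.
set y := x.+3 in IHx *; case y_odd: (odd y).
  have -> : y = (2 * y./2).+1 by lia.
  set m := y./2; have -> : (2 * m).+2 = m.+2 + m by lia.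
  rewrite /primes_between iotaD filter_cat big_cat /= add0n.
  have -> : (2 * m).+1 = m.+1 + m by lia.
  rewrite expnD; apply: leq_mul; first by apply: IHx; lia.
  apply: leq_trans (bin_odd_le m).
  apply: dvdn_leq (prod_primes_between_dvd m).
  by rewrite bin_gt0; lia.
have -> : primes_between 0 y.+1 = primes_between 0 y.
  rewrite /primes_between -[y.+1]addn1 iotaD filter_cat /= add0n.
  case: ifP => [y_pr|]; last by rewrite cats0.
  by have := even_prime y_pr; rewrite y_odd; case.
apply: leq_trans (IHx x.+2 _) _ => //.
by rewrite leq_pexp2l.
Qed.

(** * Primes below twice a number *)

Lemma divn_double_bounds N d :
  0 < d -> 2 * (N %/ d) <= (2 * N) %/ d <= (2 * (N %/ d)).+1.
Proof.
move=> d_gt0; rewrite leq_divRL // -mulnA leq_mul2l leq_divM /=.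
rewrite -ltnS ltn_divLR //; have := ltn_ceil N d_gt0; lia.
Qed.

Lemma logn_central_bin p N :
  prime p ->
  logn p 'C(2 * N, N)
  = \sum_(1 <= k < (2 * N).+1) ((2 * N) %/ p ^ k - 2 * (N %/ p ^ k)).
Proof.
move=> p_pr; have p_gt1 := prime_gt1 p_pr.
have logN : logn p N`! = \sum_(1 <= k < (2 * N).+1) N %/ p ^ k.
  rewrite logn_fact // [RHS](@big_cat_nat _ _ _ N.+1) //=; last by lia.
  rewrite [X in _ = _ + X]big_nat_cond [X in _ = _ + X]big1 ?addn0 // => k.
  move=> /andP[/andP[lt_Nk _] _]; rewrite divn_small //.
  exact: ltn_trans lt_Nk (ltn_expl k p_gt1).
have := @bin_fact (2 * N) N ltac:(lia); have -> : 2 * N - N = N by lia.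
move=> /(congr1 (logn p)); rewrite !lognM ?muln_gt0 ?fact_gt0 ?bin_gt0 //; last by lia.
rewrite logN (logn_fact (2 * N)) // => E.
rewrite addnn -mul2n big_distrr /= in E.
apply: (@addIn (\sum_(1 <= k < (2 * N).+1) 2 * (N %/ p ^ k))).
rewrite E -big_split /=; apply: eq_bigr => k _.
by rewrite subnK //; have /andP[] := @divn_double_bounds N (p ^ k) ltac:(lia).
Qed.

(** Each term of [logn_central_bin] is at most 1, and it vanishes once
    p^k > 2N. *)
Lemma pfactor_central_bin_le p N :
  prime p -> 0 < N -> p ^ logn p 'C(2 * N, N) <= 2 * N.
Proof.
move=> p_pr N_gt0; have p_gt1 := prime_gt1 p_pr.
have N2_gt0 : 0 < 2 * N by rewrite muln_gt0.
set t := trunc_log p (2 * N).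
apply: leq_trans (trunc_logP p_gt1 N2_gt0); rewrite leq_pexp2l ?(ltnW p_gt1) //.
rewrite logn_central_bin // -/t.
have count_le M : \sum_(1 <= k < M.+1) (k <= t) <= t.
  elim: M => [|M IHM]; first by rewrite big_geq.
  case: (leqP M.+1 t) => [le_t|lt_t].
    apply: leq_trans le_t; rewrite -[leqRHS]muln1 -[M.+1]/(M.+2 - 1).
    by rewrite -sum_nat_const_nat; apply: leq_sum => k _; apply: leq_b1.
  by rewrite big_nat_recr //= [M < t]leqNgt lt_t addn0.
apply: leq_trans (count_le (2 * N)); apply: leq_sum => k _.
have /andP[_ le1] := @divn_double_bounds N (p ^ k) ltac:(lia).
case: (leqP k t) => [_|lt_k]; first by lia.
rewrite divn_small //; rewrite ltnNge; apply: contraL lt_k => le_k.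
by rewrite -leqNgt trunc_log_max.
Qed.

Lemma logn_central_bin_large p N :
  prime p -> 2 * N < p * p -> logn p 'C(2 * N, N) <= 1.
Proof.
move=> p_pr lt_pp; have p_gt1 := prime_gt1 p_pr.
case: (posnP N) => [->|N_gt0]; first by rewrite muln0 bin0 logn1.
have := pfactor_central_bin_le p_pr N_gt0; set l := logn _ _ => le_pl.
rewrite leqNgt; apply/negP => l_gt1.
have : p ^ 2 <= p ^ l by rewrite leq_pexp2l // ltnW.
by rewrite expnS expn1; lia.
Qed.

(** For 2N/3 < p <= N, the prime p occurs twice in (2N)! and twice in
    (N!)^2. *)
Lemma logn_central_bin_gap p N :
  prime p -> 2 < N -> 2 * N < 3 * p -> p <= N -> logn p 'C(2 * N, N) = 0.
Proof.
move=> p_pr N_gt2 lt_3p le_pN; rewrite logn_central_bin // big_nat_cond big1 //.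
move=> k /andP[/andP[k_gt0 _] _]; case: k k_gt0 => // -[|k] _.
  have -> : (2 * N) %/ p ^ 1 = 2.
    by apply/eqP; rewrite expn1 eqn_leq -ltnS ltn_divLR ?leq_divRL ?prime_gt0 //; lia.
  have -> // : N %/ p ^ 1 = 1.
  by apply/eqP; rewrite expn1 eqn_leq -ltnS ltn_divLR ?leq_divRL ?prime_gt0 //; lia.
have p_gt2 : 2 < p by lia.
have q_gt0 : 0 < p ^ k by rewrite expn_gt0 prime_gt0.
rewrite divn_small // !expnS; move: (p ^ k) q_gt0 => q q_gt0; apply: leq_trans lt_3p _.
rewrite mulnC leq_mul2l; apply/orP; right; exact: leq_trans (leq_pmulr _ q_gt0).
Qed.

Lemma prod_nat_seq_le (I : eqType) (s : seq I) (F G : I -> nat) :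
  (forall i, i \in s -> F i <= G i) -> \prod_(i <- s) F i <= \prod_(i <- s) G i.
Proof.
elim: s => [|i s IHs] le_FG; first by rewrite !big_nil.
rewrite !big_cons; apply: leq_mul; first by apply: le_FG; rewrite mem_head.
by apply: IHs => j js; apply: le_FG; rewrite in_cons js orbT.
Qed.

(** The prime powers in the central binomial coefficient are at most 2N each.
    This is used for the primes p <= s, with s about the square root of 2N, and
    for those in (N, 2N].  The primes between s and 2N/3 occur at most once and
    contribute at most the primorial of 2N/3; those between 2N/3 and N do not
    occur. *)
Lemma central_bin_le N s :
  2 < N -> 2 * N < s.+1 * s.+1 ->
  'C(2 * N, N)
  <= (2 * N) ^ (s + size (primes_between N.+1 N)) * 4 ^ (2 * N %/ 3).
Proof.
move=> N_gt2 lt_s; have B_gt0 : 0 < 'C(2 * N, N) by rewrite bin_gt0; lia.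
rewrite [leqLHS]prod_prime_decomp // prime_decompE big_map /=.
pose big p := if N < p then 2 * N else 1.
pose mid p := if 3 * p <= 2 * N then p else 1.
pose small p := if p <= s then 2 * N else 1.
have [uQ pQ] := primes_betweenP 0 (2 * N).+1.
set Q := primes_between 0 (2 * N).+1 in uQ pQ.
have le_factor p : p \in primes 'C(2 * N, N) ->
    p ^ logn p 'C(2 * N, N) <= small p * mid p * big p.
  rewrite mem_primes => /and3P[p_pr _ _]; have p_gt0 := prime_gt0 p_pr.
  have le_2N := @pfactor_central_bin_le p N p_pr ltac:(lia).
  rewrite /small; case: (leqP p s) => [_|lt_sp].
    apply: leq_trans le_2N _; rewrite -mulnA leq_pmulr // muln_gt0.
    by rewrite /mid /big; do 2!case: ifP; lia.
  rewrite mul1n /big; case: (ltnP N p) => [_|le_pN].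
    by apply: leq_trans le_2N _; rewrite leq_pmull // /mid; case: ifP.
  rewrite muln1 /mid; case: (leqP (3 * p) (2 * N)) => [_|lt_3p]; last first.
    by rewrite logn_central_bin_gap.
  rewrite -[leqRHS]expn1 leq_pexp2l // logn_central_bin_large //.
  by apply: leq_trans lt_s _; apply: leq_mul.
have sub_Q : {subset primes 'C(2 * N, N) <= Q}.
  move=> p; rewrite mem_primes => /and3P[p_pr _ p_B].
  rewrite mem_filter p_pr mem_iota /= ltnS.
  apply: leq_trans (@pfactor_central_bin_le p N p_pr _); last by lia.
  rewrite -{1}[p]expn1; apply: leq_pexp2l; first exact: prime_gt0.
  by rewrite logn_gt0 mem_primes p_pr B_gt0.
apply: leq_trans (prod_nat_seq_le le_factor) _.
apply: (@leq_trans (\prod_(p <- Q) (small p * mid p * big p))).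
  apply: prod_le_subset; rewrite ?primes_uniq // => p /(allP pQ)/prime_gt0 p_gt0.
  by rewrite !muln_gt0 /small /mid /big; do 3!case: ifP; lia.
rewrite !big_split /= mulnAC expnD.
have prod_2N (a : pred nat) M : size [seq p <- Q | a p] <= M ->
    \prod_(p <- Q) (if a p then 2 * N else 1) <= (2 * N) ^ M.
  move=> le_M; rewrite -big_mkcond -big_filter big_const_seq count_predT.
  by rewrite iter_muln_1 leq_pexp2l //; lia.
apply: leq_mul; first apply: leq_mul.
- apply: prod_2N; rewrite -[leqRHS](size_iota 1); apply: uniq_leq_size.
    exact: filter_uniq.
  move=> p; rewrite mem_filter mem_iota => /andP[le_ps /(allP pQ)/prime_gt0 p_gt0].
  by rewrite p_gt0 add1n ltnS.
- apply: prod_2N; apply: uniq_leq_size; first exact: filter_uniq.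
  move=> p; rewrite !mem_filter !mem_iota => /andP[lt_Np /andP[-> /andP[_ lt_p]]].
  by rewrite lt_Np /=; lia.
- rewrite /mid -big_mkcond -big_filter.
  apply: leq_trans (primorial_le _).
  have [uP pP] := primes_betweenP 0 (2 * N %/ 3).+1.
  apply: prod_le_subset => // [|p /(allP pP)/prime_gt0 //|p]; first exact: filter_uniq.
  rewrite !mem_filter !mem_iota => /andP[le_3p /andP[-> _]] /=.
  by rewrite add0n ltnS leq_divRL // mulnC.
Qed.

(** Comparison of the lower bound 4^N / 2N for the central binomial coefficient
    with [central_bin_le], on a logarithmic scale: b bounds the logarithm of
    2N. *)
Lemma many_primes N s b :
  2 < N -> 2 * N < s.+1 * s.+1 -> 2 * N <= 2 ^ b ->
  2 * N <= 3 * (b * (s + size (primes_between N.+1 N)).+1).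
Proof.
move=> N_gt2 lt_s le_b; set k := size _.
have := @leq_central_bin N ltac:(lia).
move=> /leq_trans/(_ (leq_mul (leqnn _) (central_bin_le N_gt2 lt_s))); rewrite -/k.
rewrite mulnA -expnS -(expnM 2 2) -(expnM 2 2).
move=> le_pow; have : 2 ^ (2 * N) <= 2 ^ (b * (s + k).+1 + 2 * (2 * N %/ 3)).
  apply: leq_trans le_pow _; rewrite expnD leq_mul // expnM.
  by rewrite leq_exp2r.
rewrite leq_exp2l //; move: (b * _) => c; lia.
Qed.

(** There are at least k primes in (N, 2N], all of them odd, and only k - 1 odd
    numbers exceed 2N + 1 - 2k; so the least of these primes does not. *)
Lemma prime_below_double N s b k :
  2 < N -> 2 * N < s.+1 * s.+1 -> 2 * N <= 2 ^ b ->
  0 < k -> 3 * (b * (s + k)) < 2 * N ->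
  exists2 p, prime p & N < p <= 2 * N + 1 - 2 * k.
Proof.
move=> N_gt2 lt_s le_b k_gt0 lt_k.
have := many_primes N_gt2 lt_s le_b; set l := size _ => le_l.
have le_kl : k <= l by rewrite leqNgt; apply/negP => lt_lk; nia.
have [/hasP[p]|none] := boolP (has prime (iota N.+1 (N + 1 - 2 * k))).
  by rewrite mem_iota => p_bd p_pr; exists p => //; lia.
have b_gt2 : 2 < b by rewrite -(ltn_exp2l _ _ (isT : 1 < 2)); lia.
have le_2kN : 2 * k <= N by nia.
have count_odd a j : count odd (iota (2 * a) (2 * j).+1) = j.
  elim: j => [|j IHj]; first by rewrite /= oddM.
  have -> : (2 * j.+1).+1 = (2 * j).+1 + 2 by lia.
  by rewrite iotaD count_cat IHj /= oddD oddM /= oddM /=; lia.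
suff : l <= k.-1 by lia.
rewrite /l -[leqRHS](count_odd (N + 1 - k)) -size_filter.
apply: uniq_leq_size; first by rewrite filter_uniq ?iota_uniq.
move=> p; rewrite !mem_filter !mem_iota => /andP[p_pr p_bd].
have -> /= : odd p by case: (even_prime p_pr) => //; lia.
have : ~~ (p < N.+1 + (N + 1 - 2 * k)).
  by apply: contra none => ?; apply/hasP; exists p; rewrite // mem_iota; lia.
by lia.
Qed.

(** * Large lengths *)

Lemma sieve_constant_le : sieve_constant <= 2 ^ 25.
Proof.
rewrite /sieve_constant /small_sieve_primes !big_cons big_nil.
rewrite /sieve_weight /small_sieve_weights /=; lia.
Qed.

(** The condition on n under which [fillable_insert] reduces the length n to
    the length m; the exception 3 is excluded for m. *)
Definition reducible n :=
  exists m, [/\ 3 < m, prime (2 * n + (2 * m).+1)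
              & 2 ^ 25 * m ^ 4 <= ((n - m) %/ 6) ^ 5].

(** The comparison of n with a power of its logarithm that decides how large n
    must be: b - 4 is log n, and n must exceed a multiple of (log n)^5. *)
Lemma pow2_beats_power5 b : 72 < b -> 5 * b * (2 ^ 26 * (5 * b) ^ 4) <= 2 ^ (b - 4).
Proof.
move=> b_gt72; rewrite mulnCA -expnS; have [t ->] : exists t, b = t + 73
  by exists (b - 73); lia.
elim: t => [|t IHt]; first by rewrite add0n -[73 - 4]/69; lia.
have -> : t.+1 + 73 - 4 = (t + 73 - 4).+1 by lia.
rewrite [leqRHS]expnS; apply: leq_trans _ (leq_mul (leqnn 2) IHt).
rewrite mulnCA leq_mul2l; apply/orP; right.
by rewrite !expnMn mulnCA leq_mul2l; apply/orP; right; rewrite !expnS; nia.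
Qed.

(** With l about n / (5b), the fifth power on the right gains one factor l over
    m^4, against a loss of (5b)^4. *)
Lemma pow4_le_pow5 b n l m :
  2 ^ 26 * (5 * b) ^ 4 <= l -> n < l.+1 * (5 * b) -> m <= n ->
  2 ^ 25 * m ^ 4 <= l ^ 5.
Proof.
move=> l_ge lt_n le_mn.
have b_gt0 : 0 < b by move: lt_n; rewrite lt0n; apply: contraTneq => ->; lia.
have l_ge6 : 6 <= l.
  apply: leq_trans l_ge; apply: (@leq_trans (6 * 1)) => //.
  by apply: leq_mul; [lia | rewrite expn_gt0; lia].
have m_le : m ^ 4 <= (5 * b) ^ 4 * (2 * l ^ 4).
  apply: (@leq_trans ((l.+1 * (5 * b)) ^ 4)); first by rewrite leq_exp2r //; lia.
  rewrite expnMn mulnC leq_mul2l; apply/orP; right.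
  by clear -l_ge6; rewrite !expnS; nia.
apply: leq_trans (leq_mul (leqnn _) m_le) _.
rewrite [leqRHS]expnS; apply: leq_trans (leq_mul l_ge (leqnn _)).
by move: ((5 * b) ^ 4) (l ^ 4) => x y; clear; lia.
Qed.

(** [prime_below_double] is applied to N = 2n + 7, so that m > 3.  With b about
    log n, the k there can be chosen of order n / b, and then
    n - m >= k - 7 >= 6 l with l = n / (5b). *)
Lemma reducible_large n : 2 ^ 69 <= n -> reducible n.
Proof.
move=> n_large; have n_gt0 : 0 < n by apply: leq_trans n_large; rewrite expn_gt0.
have /andP[] := @trunc_log_bounds 2 n isT n_gt0; set j := trunc_log 2 n => le_j lt_j.
have j_ge69 : 68 < j by rewrite -ltnS -(@ltn_exp2l 2) //; apply: leq_ltn_trans lt_j.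
have n_ge30 : 2 ^ 30 <= n by apply: leq_trans n_large; rewrite leq_exp2l.
pose b := j + 4; have b_gt72 : 72 < b by rewrite /b; lia.
have := pow2_beats_power5 b_gt72; rewrite addnK => /leq_trans/(_ le_j).
have : 1000 * b <= 2 ^ 26 * (5 * b) ^ 4.
  apply: leq_mul; first by lia.
  apply: (@leq_trans ((5 * b) ^ 1)); first by rewrite expn1; lia.
  by rewrite leq_pexp2l //; lia.
move wE : (2 ^ 26 * (5 * b) ^ 4) => w w_ge n_ge.
have le_b : 2 * (2 * n + 7) <= 2 ^ b.
  by rewrite /b expnD; move: lt_j; rewrite expnS; lia.
have [s s_ge s_le] : exists2 s, 2 ^ b <= s * s & s * s <= 32 * n.
  exists (2 ^ uphalf b); rewrite -expnD addnn; first by rewrite leq_exp2l //; lia.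
  apply: (@leq_trans (2 ^ (j + 5))); first by rewrite leq_exp2l // /b; lia.
  by rewrite expnD; lia.
have le_2N_ss : 2 * (2 * n + 7) <= s * s := leq_trans le_b s_ge.
clearbody b; clear n_large lt_j le_j s_ge j_ge69 j.
have [l [l_ge l_le l_gt]] : exists l,
    [/\ w <= l, l * (5 * b) <= n & n < l.+1 * (5 * b)].
  exists (n %/ (5 * b)); split; [|exact: leq_divM|apply: ltn_ceil; lia].
  by rewrite leq_divRL; [rewrite mulnC | lia].
have [k k_ge k_le] : exists2 k, 6 * l + 7 <= k & k * (4 * b) <= 5 * n.
  exists ((5 * n) %/ (4 * b)); rewrite ?leq_divM // leq_divRL; last by lia.
  by clear -l_le w_ge l_ge n_ge b_gt72; nia.
have s_small : 12 * (b * s) <= n.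
  clear -s_le n_ge w_ge b_gt72; rewrite leqNgt; apply/negP => lt_n.
  have : n * n < 12 * (b * s) * (12 * (b * s)) by apply: ltn_mul.
  have : 144 * (b * b) * (s * s) <= 144 * (b * b) * (32 * n) by rewrite leq_mul2l s_le orbT.
  have : 4608 * (b * b) <= n by nia.
  nia.
have N_gt2 : 2 < 2 * n + 7 by clear; lia.
have lt_s : 2 * (2 * n + 7) < s.+1 * s.+1.
  by apply: leq_ltn_trans le_2N_ss _; apply: ltn_mul.
have k_gt0 : 0 < k by clear -k_ge; lia.
have lt_sk : 3 * (b * (s + k)) < 2 * (2 * n + 7).
  by clear -s_small k_le; rewrite mulnDr; lia.
have [p p_pr p_bd] := prime_below_double N_gt2 lt_s le_b k_gt0 lt_sk.
have p_odd : odd p by case: (even_prime p_pr) => // p2; clear -p2 p_bd; lia.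
have [m pE] : exists m, p = 2 * n + (2 * m).+1.
  by exists ((p - (2 * n).+1)./2); clear -p_odd p_bd; lia.
exists m; rewrite -pE; split=> //; first by clear -pE p_bd; lia.
have le_mn : m <= n by clear -pE p_bd k_ge; lia.
have le_l : l <= (n - m) %/ 6 by rewrite leq_divRL //; clear -pE p_bd k_ge le_mn; lia.
apply: (@leq_trans (l ^ 5)); last by rewrite leq_exp2r.
rewrite -wE in l_ge; exact: pow4_le_pow5 l_ge l_gt le_mn.
Qed.

(** * Certified primality *)

Lemma N_div_divn x q :
  q <> N0 -> N.to_nat (N.div x q) = N.to_nat x %/ N.to_nat q.
Proof.
move=> q_neq0; have xE := N.div_mod x q q_neq0.
have lt_r := N.mod_lt x q q_neq0; rewrite {2}xE.
move: (N.div x q) (N.modulo x q) lt_r => a r lt_r.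
have -> : N.to_nat (N.add (N.mul q a) r) = N.to_nat a * N.to_nat q + N.to_nat r by lia.
by rewrite divnMDl ?divn_small ?addn0 //; lia.
Qed.

Lemma N_mod_modn x q :
  q <> N0 -> N.to_nat (N.modulo x q) = N.to_nat x %% N.to_nat q.
Proof.
move=> q_neq0; have xE := N.div_mod x q q_neq0.
have lt_r := N.mod_lt x q q_neq0; rewrite {2}xE.
move: (N.div x q) (N.modulo x q) lt_r => a r lt_r.
have -> : N.to_nat (N.add (N.mul q a) r) = N.to_nat a * N.to_nat q + N.to_nat r by lia.
by rewrite modnMDl modn_small //; lia.
Qed.

Fixpoint N_pow_mod (a : N) (e : positive) (q : N) : N :=
  match e with
  | xH => N.modulo a q
  | xO e' => let y := N_pow_mod a e' q in N.modulo (N.mul y y) q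
  | xI e' => let y := N_pow_mod a e' q in
             N.modulo (N.mul (N.modulo (N.mul y y) q) a) q
  end.

Lemma N_pow_modP a e q :
  q <> N0 ->
  N.to_nat (N_pow_mod a e q) = N.to_nat a ^ Pos.to_nat e %% N.to_nat q.
Proof.
move=> q_neq0; have mulE (x y : N) :
    N.to_nat (N.mul x y) = N.to_nat x * N.to_nat y.
  by lia.
elim: e => [e IHe|e IHe|] /=; last by rewrite N_mod_modn.
- rewrite !N_mod_modn // !mulE N_mod_modn // mulE IHe.
  have -> : Pos.to_nat e~1 = (Pos.to_nat e + Pos.to_nat e).+1 by lia.
  by rewrite expnSr expnD modnMm modnMml.
- rewrite !N_mod_modn // !mulE IHe.
  have -> : Pos.to_nat e~0 = Pos.to_nat e + Pos.to_nat e by lia.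
  by rewrite expnD modnMm.
Qed.

(** Proth's criterion.  Let p be a prime divisor of N = k 2^(j+1) + 1, with
    p^2 <= N, and let x be the given power of a, so x = -1 mod p.  If
    2^(j+1) does not divide p - 1, then the 2-part of p - 1 divides 2^j, and by
    Fermat an odd power of x is 1; together with x^2 = 1 this gives x = 1,
    whence p = 2, which is absurd.  Otherwise p > 2^(j+1) > k, so that
    p^2 > N. *)
Lemma prime_proth a k j :
  k < 2 ^ j.+1 -> k * 2 ^ j.+1 + 1 %| a ^ (k * 2 ^ j) + 1 ->
  0 < k -> prime (k * 2 ^ j.+1 + 1).
Proof.
set N := _ + 1 => lt_k N_dvd k_gt0.
apply: contraT => /primePns[|[p [p_pr le_p2 p_N]]].
  by have := expn_gt0 2 j.+1; rewrite /N; lia.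
have p_gt1 := prime_gt1 p_pr.
have p_odd : odd p by apply: (dvdn_odd p_N); rewrite /N oddD oddM oddX /= andbF.
have p_x : p %| a ^ (k * 2 ^ j) + 1 := dvdn_trans p_N N_dvd.
suff dvd_p : 2 ^ j.+1 %| p.-1.
  have le_p : 2 ^ j.+1 <= p.-1 by apply: dvdn_leq dvd_p; lia.
  exfalso; move: lt_k le_p le_p2; rewrite /N -mulnn.
  by move: (2 ^ j.+1) => M; nia.
have pp_gt0 : 0 < p.-1 by lia.
have [|lt_ij] := leqP j.+1 (logn 2 p.-1).
  by move=> le_j; rewrite -pfactor_dvdn // in le_j.
set i := logn 2 p.-1 in lt_ij; set t := p.-1 %/ 2 ^ i.
have pE : p.-1 = t * 2 ^ i by rewrite divnK // pfactor_dvdnn.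
have t_odd : odd t.
  have : coprime 2 t.
    rewrite prime_coprime //; apply/negP => t2.
    have : 2 ^ i.+1 %| p.-1 by rewrite pE expnS dvdn_mul.
    by rewrite pfactor_dvdn // ltnn.
  by rewrite coprime2n.
set x := a ^ (k * 2 ^ j) in p_x.
have a_p : coprime a p.
  rewrite coprime_sym prime_coprime //; apply/negP => p_a.
  have p_xx : p %| x by rewrite /x Euclid_dvdX // p_a muln_gt0 k_gt0 expn_gt0.
  by move: p_x; rewrite dvdn_addr // dvdn1 => /eqP p1; rewrite p1 in p_gt1.
have a_gt0 : 0 < a by move: a_p; rewrite /coprime; case: (a) => //; rewrite gcd0n; lia.
have x_t : x ^ t = 1 %[mod p].
  rewrite /x -expnM -mulnA (_ : 2 ^ j * t = p.-1 * 2 ^ (j - i)); last first.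
    by rewrite pE -mulnA -expnD subnKC 1?mulnC.
  rewrite mulnCA expnM -modnXm; have := Euler_exp_totient a_p.
  by rewrite totient_prime // => ->; rewrite modnXm exp1n.
have x_2 : x ^ 2 = 1 %[mod p].
  apply/eqP; rewrite eqn_mod_dvd; last by rewrite !expn_gt0 a_gt0.
  by rewrite -{2}(exp1n 2) subn_sqr dvdn_mull.
have : x = 1 %[mod p].
  rewrite -x_t -(odd_double_half t) t_odd add1n expnS -mul2n expnM.
  by rewrite -modnMmr -modnXm x_2 modnXm exp1n modnMmr muln1.
move=> x_1; have : p %| 2.
  by move: p_x; rewrite /dvdn -modnDml x_1 modnDml.
by move=> /dvdn_leq -/(_ isT) le_p2'; move: p_odd; have -> : p = 2 by lia.
Qed.

Fixpoint no_divisor_from (fuel : nat) (d q : N) : bool :=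
  if fuel is fuel'.+1 then
    if N.ltb q (N.mul d d) then true
    else if N.eqb (N.modulo q d) N0 then false
    else no_divisor_from fuel' (N.add d 2) q
  else false.

Definition trial_prime fuel (q : N) :=
  [&& N.odd q, N.ltb 1 q & no_divisor_from fuel 3 q].

Lemma no_divisor_fromP fuel d q r :
  no_divisor_from fuel d q -> N.odd d -> odd r -> N.to_nat d <= r ->
  r * r <= N.to_nat q -> ~~ (r %| N.to_nat q).
Proof.
elim: fuel d => //= fuel IHf d; case: N.ltb_spec0 => [lt_q _ _ _|_]; first by nia.
case: N.eqb_spec => // nmod rec d_odd r_odd le_dr le_rr.
case: (eqVneq r (N.to_nat d)) => [->|neq].
  apply/negP => d_q; apply: nmod; have d_neq0 : d <> N0 by case: (d) d_odd.
  by have := N_mod_modn q d_neq0; rewrite (eqP d_q); lia.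
apply: (IHf _ rec _ r_odd _ le_rr); first by rewrite N.odd_add d_odd.
have d_odd' : odd (N.to_nat d).
  have := N.odd_spec d; rewrite d_odd => -[/(_ isT)[c ->] _]; lia.
have : r != (N.to_nat d).+1 by apply: contraTneq r_odd => ->; rewrite /= d_odd'.
by lia.
Qed.

Lemma trial_primeP fuel q : trial_prime fuel q -> prime (N.to_nat q).
Proof.
move=> /and3P[q_odd /N.ltb_spec0 q_gt1 none].
have q_odd' : odd (N.to_nat q).
  have := N.odd_spec q; rewrite q_odd => -[/(_ isT)[c ->] _]; lia.
apply: contraT => /primePns[|[r [r_pr le_r2 r_q]]]; first by lia.
have r_odd := dvdn_odd r_q q_odd'; have r_gt1 := prime_gt1 r_pr.
have r_ge3 : 3 <= r by move: r_odd r_gt1; case: (r) => [|[|[|]]].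
have le_rr : r * r <= N.to_nat q by rewrite mulnn.
by have := no_divisor_fromP none isT r_odd r_ge3 le_rr; rewrite r_q.
Qed.

(** The number tested is q = 2e + 1 with e = k 2^j. *)
Definition proth_prime (a k j : N) :=
  let h := N.pow 2 j in
  let e := N.mul k h in
  let q := N.succ_double e in
  N.ltb k (N.double h) &&
  (if e is Npos e' then N.eqb (N.succ (N_pow_mod a e' q)) q else false).

Lemma N_pow_expn a j : N.to_nat (N.pow a j) = N.to_nat a ^ N.to_nat j.
Proof.
elim/N.peano_ind: j => [|j IHj] //.
by rewrite N.pow_succ_r' N2Nat.inj_succ expnS -IHj; lia.
Qed.

Lemma proth_primeP a k j :
  proth_prime a k j -> prime (N.to_nat (N.succ_double (N.mul k (N.pow 2 j)))).
Proof.
rewrite /proth_prime; case eE: (N.mul k (N.pow 2 j)) => [|e]; rewrite ?andbF //.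
case/andP=> /N.ltb_spec0 lt_k /N.eqb_spec powE.
have := @N_pow_modP a e (N.succ_double (Npos e)) ltac:(by []).
have qE : N.to_nat (N.succ_double (Npos e))
    = N.to_nat k * 2 ^ (N.to_nat j).+1 + 1.
  by rewrite -eE expnS -(N_pow_expn 2); lia.
have posE : Pos.to_nat e = N.to_nat k * 2 ^ N.to_nat j.
  by rewrite -(N_pow_expn 2); lia.
rewrite qE posE => modE; apply: (@prime_proth (N.to_nat a)).
- by rewrite expnS -(N_pow_expn 2); lia.
- rewrite /dvdn -modnDml -modE addn1 -qE.
  have -> : (N.to_nat (N_pow_mod a e (N.succ_double (N.pos e)))).+1
    = N.to_nat (N.succ_double (N.pos e)) by lia.
  by rewrite modnn.
- have : k <> N0 by move=> k0; rewrite k0 in eE.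
  by lia.
Qed.

(** * Intermediate lengths: a chain of primes *)

Definition N_room (n m : N) : bool :=
  N.leb (N.mul (N.pow 2 25) (N.pow m 4)) (N.pow (N.div (N.sub n m) 6) 5).

(** The largest m' with 2^25 m'^4 <= ((n - m) / 6)^5, kept below n.  Iterated
    from m = 0 it approximates the largest m that [reducible] admits. *)
Definition N_depth (n m : N) : N :=
  N.min (N.div (N.mul 9 n) 10)
    (N.sqrt (N.sqrt (N.div (N.pow (N.div (N.sub n m) 6) 5) (N.pow 2 25)))).

(** Four iterations are close enough; the result is only a starting point for
    the search and is checked by [N_room]. *)
Definition N_reach (n : N) : N := iter 4 (N_depth n) N0.

(** The searches return a number c such that 2c + 1 is prime, starting from a
    given one and going down.  Trial division by the odd numbers up to 2001
    decides primality below 4 * 10^6, which covers the range of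
    [trial_search]. *)
Fixpoint trial_search fuel (c : N) : option N :=
  if fuel is fuel'.+1 then
    if trial_prime 1000 (N.succ_double c) then Some c
    else trial_search fuel' (N.pred c)
  else None.

(** The filter saves exponentiations: for q = 1 mod 4, the base 3 can succeed
    in Proth's criterion only if it is not a square mod q, that is, if
    q = 2 mod 3 by quadratic reciprocity; and q should have no small
    factor. *)
Fixpoint proth_search fuel (k j : N) : option N :=
  if fuel is fuel'.+1 then
    let c := N.mul k (N.pow 2 j) in
    let q := N.succ_double c in
    let sifted := if N.eqb (N.modulo q 3) 2
      then all (fun r => ~~ N.eqb (N.modulo q r) 0)
             [:: 5; 7; 11; 13; 17; 19; 23; 29; 31; 37]%num
      else false in
    if (if sifted then proth_prime 3 k j else false)
    then Some c else proth_search fuel' (N.pred k) j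
  else None.

(** From the upper half of the binary digits of c, the numbers k 2^j with k
    about 2^j are reached, to which Proth's criterion applies.  Their spacing,
    of the order of the square root of c, is negligible for large c. *)
Definition prime_search (c : N) :=
  if N.ltb c 1500000 then trial_search 200 c
  else let j := N.div2 (N.size c) in proth_search 2000 (N.shiftr c j) j.

(** A prime 2c + 1 serves every n from lo to c - 4, with m = c - n: then
    2n + 2m + 1 = 2c + 1, and the room is smallest at n = lo. *)
Fixpoint prime_chain fuel (lo hi : N) : bool :=
  if N.leb hi lo then true else
  if fuel is fuel'.+1 then
    if prime_search (N.add lo (N_reach lo)) is Some c then
      [&& N.leb (N.add lo 4) c, N_room lo (N.sub c lo)
        & prime_chain fuel' (N.sub c 3) hi]
    else false
  else false.

Lemma trial_searchP fuel c d :
  trial_search fuel c = Some d -> prime (N.to_nat (N.succ_double d)).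
Proof.
elim: fuel c => //= fuel IHf c; case: ifP => [/trial_primeP pr_c [<-] //|_].
exact: IHf.
Qed.

Lemma proth_searchP fuel k j d :
  proth_search fuel k j = Some d -> prime (N.to_nat (N.succ_double d)).
Proof.
elim: fuel k => //= fuel IHf k; case: ifP => [|_]; last exact: IHf.
by case: ifP => // _ /proth_primeP pr_k [<-].
Qed.

Lemma prime_searchP c d :
  prime_search c = Some d -> prime (2 * N.to_nat d).+1.
Proof.
have -> : (2 * N.to_nat d).+1 = N.to_nat (N.succ_double d) by lia.
by rewrite /prime_search; case: ifP => _; [apply: trial_searchP | apply: proth_searchP].
Qed.

Lemma N_roomP n m :
  N_room n m -> 2 ^ 25 * N.to_nat m ^ 4 <= ((N.to_nat n - N.to_nat m) %/ 6) ^ 5.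
Proof.
move=> /N.leb_spec0 room.
have divE : (N.to_nat n - N.to_nat m) %/ 6 = N.to_nat (N.div (N.sub n m) 6).
  by rewrite N_div_divn // N2Nat.inj_sub.
rewrite divE -(N_pow_expn _ 5) -(N_pow_expn _ 4) -(N_pow_expn 2 25).
by move: (N.pow 2 25) (N.pow m 4) (N.pow _ 5) room => x y z; lia.
Qed.

Lemma prime_chainP fuel lo hi n :
  prime_chain fuel lo hi -> N.to_nat lo <= n < N.to_nat hi -> reducible n.
Proof.
elim: fuel lo => [|fuel IHf] lo /=; case: N.leb_spec0 => [|_] //; try by lia.
case search: prime_search => [c|//] /and3P[/N.leb_spec0 le_c /N_roomP room chain].
case/andP=> le_lo lt_hi.
have [lt_nc|le_cn] := ltnP n (N.to_nat c - 3); last by apply: IHf chain _; lia.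
exists (N.to_nat c - n); split; first by lia.
  by have := prime_searchP search; congr prime; lia.
apply: leq_trans (leq_trans _ room) _.
  by rewrite leq_mul2l leq_exp2r //; apply/orP; right; lia.
by rewrite leq_exp2r // leq_div2r //; lia.
Qed.

Lemma reducible_mid n : 2000 <= n < 2 ^ 69 -> reducible n.
Proof.
have chain : prime_chain 2000 2000 (N.pow 2 69) by vm_compute.
move=> n_bd; apply: (prime_chainP chain).
have -> : N.to_nat (N.pow 2 69) = 2 ^ 69 by rewrite N_pow_expn.
have -> : N.to_nat 2000 = 2000 by lia.
exact: n_bd.
Qed.

(** * Small lengths: nested folds *)

(** Over binary numbers, so that the search below can be evaluated. *)
Definition N_coprime (a b : N) := N.eqb (N.gcd a b) 1.

Lemma N_coprimeP a b : N_coprime a b -> coprime (N.to_nat a) (N.to_nat b).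
Proof.
move=> /N.eqb_spec gcd1; set d := gcdn (N.to_nat a) (N.to_nat b).
have dvdN c : d %| N.to_nat c -> N.divide (N.of_nat d) c.
  by move=> /dvdnP[e E]; exists (N.of_nat e); lia.
have [e] : N.divide (N.of_nat d) 1.
  by rewrite -gcd1; apply: N.gcd_greatest; apply: dvdN; rewrite ?dvdn_gcdl ?dvdn_gcdr.
rewrite /coprime -/d => E; have : N.to_nat e * d == 1 by clearbody d; lia.
by rewrite muln_eq1 => /andP[].
Qed.

(** A conditional instead of a conjunction, so that evaluation stops at the
    first failure. *)
Definition N_compatible (x y : N * N) :=
  if N_coprime x.1 y.2 then N_coprime x.2 y.1 else false.

Definition to_column (x : N * N) := (N.to_nat x.1, N.to_nat x.2).

Lemma N_compatibleP x y :
  N_compatible x y -> compatible (to_column x) (to_column y).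
Proof.
rewrite /N_compatible /compatible; case: ifP => // /N_coprimeP cop12 /N_coprimeP.
by rewrite /= cop12.
Qed.

Definition N_fold_column (m n i : N) : N * N :=
  let a := N.add (N.double m) (N.succ i) in
  let b := N.sub (N.double n) i in
  if N.odd i then (b, a) else (a, b).

Lemma N_fold_columnE m n i :
  to_column (N_fold_column m n i)
  = fold_column (N.to_nat m) (N.to_nat n) (N.to_nat i).
Proof.
have oddE : odd (N.to_nat i) = N.odd i.
  case i_odd: (N.odd i).
    by have := N.odd_spec i; rewrite i_odd => -[/(_ isT)[c ->] _]; lia.
  have := N.even_spec i; rewrite -N.negb_odd i_odd => -[/(_ isT)[c ->] _]; lia.
rewrite /fold_column oddE /N_fold_column; case: (N.odd i); rewrite /to_column /=.
  by congr (_, _); lia.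
by congr (_, _); lia.
Qed.

(** Tries to insert at one of the first few joints of the fold of 2m+1, ..., 2n
    a ladder for m whose outer fold is that of 2l+1, ..., 2m; its end columns
    are then known. *)
Definition N_insertable (n m l : N) :=
  has (fun i =>
    if N.ltb (N.succ i) (N.sub n m) then
      if N_compatible (N_fold_column m n i) (N_fold_column l m 0)
      then N_compatible (N_fold_column l m (N.pred (N.sub m l)))
             (N_fold_column m n (N.succ i))
      else false
    else false)
  [:: 0; 1; 2; 3; 4; 5; 6; 7; 8; 9; 10]%num.

(** Entry n is the m in the outer fold 2m+1, ..., 2n of a nested fold for n;
    0 stands for the absence of an entry. *)
Definition fold_table : seq N :=
  [:: 0; 0; 1; 0; 1; 1; 2; 1; 1; 2; 1; 4; 2; 1; 1; 6; 2; 1; 2; 1; 1]%num.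

Definition table_entry (n : N) := nth N0 fold_table (N.to_nat n).

Definition table_step (n m : N) :=
  if trial_prime 1000 (N.succ_double (N.add n m)) then
    if N.eqb m 1 then true
    else if N.eqb (table_entry m) 0 then false
    else N_insertable n m (table_entry m)
  else false.

(** As the inserted ladder stands strictly inside the fold, the end columns are
    those of the fold itself; knowing them lets one insert in turn. *)
Definition fold_filled (m n : nat) :=
  exists s, [/\ covers 3 (2 * n).+1 s, head (0, 0) s = fold_column m n 0
              & last (0, 0) s = fold_column m n (n - m).-1].

Lemma last_fold_segment x0 m n i l :
  last x0 (fold_segment m n i l.+1) = fold_column m n (i + l).
Proof. by rewrite -addn1 -fold_segment_cat last_cat. Qed.

Lemma table_stepP (n m : N) :
  1 < N.to_nat n -> m <> N0 ->
  (N.to_nat m < N.to_nat n -> table_entry m <> N0 ->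
     fold_filled (N.to_nat (table_entry m)) (N.to_nat m)) ->
  table_step n m -> fold_filled (N.to_nat m) (N.to_nat n).
Proof.
move=> n_gt1 m_neq0 IH; rewrite /table_step; case: ifP => // /trial_primeP p_pr.
have {}p_pr : prime (2 * N.to_nat n + (2 * N.to_nat m).+1).
  by move: p_pr; congr prime; lia.
case: N.eqb_spec => [m1 _|m_neq1].
  have mE : N.to_nat m = 1 by lia.
  rewrite mE in p_pr *; exists (fold_segment 1 (N.to_nat n) 0 (N.to_nat n - 1)).
  split; first by apply: covers_fold; [exact: p_pr | lia].
    by have -> : N.to_nat n - 1 = (N.to_nat n - 2).+1 by lia.
  have -> : N.to_nat n - 1 = (N.to_nat n - 2).+1 by lia.
  by rewrite last_fold_segment.
case: N.eqb_spec => // entry_neq0 /hasP[i _].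
case: N.ltb_spec0 => // lt_i; case: ifP => // /N_compatibleP.
rewrite !N_fold_columnE => cut_head /N_compatibleP; rewrite !N_fold_columnE => cut_last.
have lt_mn : N.to_nat m < N.to_nat n by lia.
have [s [cov_s head_s last_s]] := IH lt_mn entry_neq0.
have lt_i' : (N.to_nat i).+1 < N.to_nat n - N.to_nat m by lia.
have := @covers_insert (N.to_nat m) (N.to_nat n) (N.to_nat i) s (0, 0) p_pr _ lt_i' cov_s.
rewrite head_s last_s => cov.
exists (fold_segment (N.to_nat m) (N.to_nat n) 0 (N.to_nat i).+1 ++ s ++
  fold_segment (N.to_nat m) (N.to_nat n) (N.to_nat i).+1
    (N.to_nat n - N.to_nat m - (N.to_nat i).+1)); split.
- apply: cov; [lia | exact: cut_head |].
  by move: cut_last; rewrite !N2Nat.inj_succ N2Nat.inj_pred N2Nat.inj_sub.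
- by [].
- have -> : N.to_nat n - N.to_nat m - (N.to_nat i).+1
    = (N.to_nat n - N.to_nat m - (N.to_nat i).+2).+1 by lia.
  by rewrite !last_cat last_fold_segment; congr fold_column; lia.
Qed.

Lemma table_entryP (n : N) :
  table_entry n <> N0 -> fold_filled (N.to_nat (table_entry n)) (N.to_nat n).
Proof.
have steps : all (fun k => let n := N.of_nat k in
    if N.eqb (table_entry n) 0 then true else table_step n (table_entry n)) (iota 0 21).
  by vm_compute.
elim/(@well_founded_ind _ N.lt N.lt_wf_0): n => n IHn entry_neq0.
have lt_n : N.to_nat n < 21.
  by rewrite ltnNge; apply/negP => ge_n; apply: entry_neq0; rewrite /table_entry nth_default.
have := allP steps (N.to_nat n); rewrite mem_iota lt_n N2Nat.id => /(_ isT) /=.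
case: N.eqb_spec => // _; apply: table_stepP => //.
  by move: entry_neq0; rewrite /table_entry; case: (N.to_nat n) => [|[|]].
by move=> lt_m; apply: IHn; lia.
Qed.

(** Every length in the range is reached from an entry of [fold_table] by one
    more fold, or is a single fold because 2n + 3 is prime. *)
Lemma fillable_small n : 3 < n < 2000 -> fillable n.
Proof.
have steps : all (fun k => has (table_step (N.of_nat k))
    [:: 1; 2; 3; 4; 5; 6; 7; 8; 9; 10; 11; 12; 13; 14; 15; 16; 17; 18; 19; 20]%num)
    (iota 4 1996) by vm_compute.
move=> n_bd; have := allP steps n; rewrite mem_iota => /(_ ltac:(lia)) /hasP[m m_in step].
have m_neq0 : m <> N0 by move=> m0; rewrite m0 in m_in.
have n_gt1 : 1 < N.to_nat (N.of_nat n) by lia.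
have [s [cov_s _ _]] := table_stepP n_gt1 m_neq0 (fun _ => @table_entryP m) step.
by exists s; move: cov_s; rewrite Nat2N.id.
Qed.

(** * All lengths *)

Lemma fillable_reducible n :
  reducible n -> (forall m, 3 < m < n -> fillable m) -> fillable n.
Proof.
move=> [m [m_gt3 p_pr room]] IH; have m_gt1 : 1 < m by lia.
have lt_mn : m < n.
  rewrite ltnNge; apply/negP => le_nm; move: room.
  rewrite (eqP le_nm) div0n exp0n // leqn0 muln_eq0 !expn_eq0 /=.
  by case: m m_gt1 {m_gt3 p_pr le_nm}.
apply: (fillable_insert p_pr m_gt1); first by apply: IH; rewrite m_gt3.
by apply: leq_trans room; rewrite leq_mul2r sieve_constant_le orbT.
Qed.

(** The lengths m in [reducible] exceed 3, so that the induction never needs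
    length 3, for which no such ladder exists: with only two columns, the odd
    label 3 meets both even labels, and one of them is 6. *)
Lemma fillable_gt3 n : 3 < n -> fillable n.
Proof.
elim/ltn_ind: n => n IHn n_gt3.
case: (ltnP n 2000) => [lt_n|ge_n]; first by apply: fillable_small; rewrite n_gt3.
apply: fillable_reducible => [|m /andP[m_gt3 lt_mn]]; last exact: IHn.
case: (ltnP n (2 ^ 69)) => [lt_n|]; last exact: reducible_large.
by apply: reducible_mid; rewrite ge_n.
Qed.

Lemma covers_from_one n s :
  0 < n -> covers 3 (2 * n).+1 s -> covers 1 (2 * n).+1 ((1, 2) :: s).
Proof.
move=> n_gt0 /andP[/andP[rs ss] perm_s]; apply/andP; split; last first.
  have -> : (2 * n).+1 - 1 = ((2 * n).+1 - 3).+2 by lia.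
  by rewrite /= !perm_cons.
rewrite /ladder_seq /= rs; case: s {perm_s} rs ss => //= x s /andP[/andP[/andP[x_odd _] _] _].
by rewrite /compatible /= coprime1n coprime2n x_odd.
Qed.

Theorem theorem1 (n : nat) (hn : 1 <= n) :
  exists f : 'I_n * 'I_2 -> nat,
    prime_labeling (@ladder n) f /\
    (forall k : nat, 1 <= k <= 2 * n -> exists v : 'I_n * 'I_2, f v = k).
Proof.
suff [s cov_s] : exists s, covers 1 (2 * n).+1 s.
  exact: covers_prime_labeling cov_s.
case: (ltnP 3 n) => [n_gt3|].
  have [s cov_s] := fillable_gt3 n_gt3.
  by exists ((1, 2) :: s); apply: covers_from_one.
case: n hn => [|[|[|[|]]]] // _ _.
- by exists [:: (1, 2)].
- by exists [:: (1, 2); (3, 4)].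
(* With (1, 2) as an end column, 3 and 6 would meet. *)
- by exists [:: (1, 6); (5, 2); (3, 4)].
Qed.
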